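(* The sequence $$1\to\mathcal{P}(\mathbb{Z})\to\mathcal{P}(\mathbb{Q})\xrightarrow{\theta_{\mathbb{Q}}}\mathcal{F}^2\xrightarrow{\rho}\mathrm{Cl}^+(K)^2\to 1$$ is an exact sequence of groups, where the first map is inclusion, $\theta_{\mathbb{Q}}$ sends a point $(x,y)\in\mathcal{P}(\mathbb{Q})$ with denominator $A$ and ratio $\beta$ to the class of $(A,\beta)$ in $\mathcal{F}^2$, and $\rho$ sends the class with data $(A,\beta)$ to the narrow ideal class of $\mathfrak{a}^2$, where $\mathfrak{a}=A\mathbb{Z}+(\beta+\omega)\mathbb{Z}$.
   Context: Let $\Delta$ be a fundamental discriminant, $K=\mathbb{Q}(\sqrt\Delta)$, $\Delta = \sigma + 4m$ with $\sigma\in\{0,1\}$, $m\in\mathbb{Z}$, $\omega=\frac{\sigma+\sqrt\Delta}{2}$, and $Q_0(x,y)=x^2+\sigma xy-my^2$. For $R\subseteq\overline{\mathbb{Q}}$, $\mathcal{P}(R)=\{(x,y)\in R^2:Q_0(x,y)=1\}$, a group under $(x_1,y_1)\oplus(x_2,y_2)=(x_1x_2+my_1y_2,\;x_1y_2+x_2y_1+\sigma y_1y_2)$. $\mathrm{Cl}^+(K)$ is the narrow ideal class group of $K$ and $\mathrm{Cl}^+(K)^2$ its subgroup of squares. For a rational point $(x,y)\in\mathcal{P}(\mathbb{Q})$ (every such point is primitive in the sense below), its denominator is $A=\operatorname{den}(y)$ (least positive integer $n$ with $ny$ an integer) and its ratio is the least non-negative integer $\beta\equiv b\pmod{A^2}$,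 where, with $a$ the least positive integer satisfying $a\equiv(A^2y)^{-1}\pmod{A^2}$, $b=aA^2x$ if $y\neq0$ and $b=0$ if $y=0$; one has $A^2\mid Q_0(\beta,1)$ and $\gcd(A,\Delta)=1$. $\mathcal{F}^2$: elements are classes of binary quadratic forms $A^2t^2+(2\beta+\sigma)tu+\frac{Q_0(\beta,1)}{A^2}u^2$ with $A$ a positive integer, $\beta\in\mathbb{Z}$, $A^2\mid Q_0(\beta,1)$; data $(A,\beta),(A',\beta')$ give the same class iff $A=A'$ and $\beta\equiv\beta'\pmod{A^2}$. Group law: for data $(A_1,\beta_1),(A_2,\beta_2)$ let $\beta^+=\beta_1+\beta_2+\sigma$, $\beta^\times=\beta_1\beta_2+m$, $e^2=\gcd(A_1^2,A_2^2,\beta^+)$, choose integers $j,k,\ell$ with $A_1^2j+A_2^2k+\beta^+\ell=e^2$, and the product has data $A_3=A_1A_2/e^2$, $\beta_3=\frac{A_1^2}{e^2}\beta_2j+\frac{A_2^2}{e^2}\beta_1k+\frac{\beta^\times}{e^2}\ell$; identity is data $(1,0)$.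
   Formalization: The ratio is defined with a ≡ (Ay)^{-1} (mod A²) and b = a·Ax, because A²y is never invertible mod A² when A > 1 (e.g. Δ = −4, (3/5, 4/5)); Δ = 1 is not counted as a fundamental discriminant. *)

(* Defs.v *)
From HB Require Import structures.
From mathcomp Require Import all_boot all_order all_algebra all_field.
From mathcomp Require Import boolp classical_sets.
From mathcomp Require Import ring zify.

Set Implicit Arguments.
Unset Strict Implicit.
Unset Printing Implicit Defensive.

Import Order.TTheory GRing.Theory Num.Theory.
Local Open Scope ring_scope.
Local Open Scope quotient_scope.
Local Open Scope classical_set_scope.

Definition squarefree (n : int) : Prop :=
  forall d : int, (d ^+ 2 %| n)%Z -> d \is a GRing.unit.

Definition fundamental (D : int) : Prop :=
  [/\ (D %% 4)%Z = 1, squarefree D & D <> 1] \/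
  exists m : int, [/\ D = 4 * m, (m %% 4)%Z = 2 \/ (m %% 4)%Z = 3
                    & squarefree m].

Record fund_disc := FundDisc { disc :> int; discP : fundamental disc }.

(* For D = 0 or 1 mod 4, the unique sigma \in {0, 1} and m with
   D = sigma + 4 m. *)
Definition sigma (D : int) : int := (D %% 4)%Z.
Definition mpar (D : int) : int := (D %/ 4)%Z.

Definition Q0 (D : int) (R : pzRingType) (x y : R) : R :=
  x ^+ 2 + (sigma D)%:~R * x * y - (mpar D)%:~R * y ^+ 2.

Section Pell.
Variables (D : int) (R : comNzRingType).

Record pell := Pell { coords :> R * R; _ : Q0 D coords.1 coords.2 == 1 }.

HB.instance Definition _ := [isSub of pell for coords].
HB.instance Definition _ := [Choice of pell by <:].

Implicit Types p q : pell.

Lemma pellP p : Q0 D p.1 p.2 = 1.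
Proof. by case: p => ? /= /eqP. Qed.

Let s : R := (sigma D)%:~R.
Let m : R := (mpar D)%:~R.

Fact pell_one_subproof : Q0 D ((1, 0) : R * R).1 ((1, 0) : R * R).2 == 1.
Proof. by apply/eqP; rewrite /Q0 /=; ring. Qed.

Fact pell_mul_subproof p q
  (r := (p.1 * q.1 + m * p.2 * q.2,
         p.1 * q.2 + q.1 * p.2 + s * p.2 * q.2)) :
  Q0 D r.1 r.2 == 1.
Proof.
apply/eqP; rewrite -[RHS]mulr1 -{1}(pellP p) -(pellP q) /Q0 /= -/s -/m; ring.
Qed.

Fact pell_inv_subproof p (r := (p.1 + s * p.2, - p.2)) : Q0 D r.1 r.2 == 1.
Proof. by apply/eqP; rewrite -(pellP p) /Q0 /= -/s -/m; ring. Qed.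

Definition pell_one := Pell pell_one_subproof.
Definition pell_mul p q := Pell (pell_mul_subproof p q).
Definition pell_inv p := Pell (pell_inv_subproof p).

Fact pell_mulA : associative pell_mul.
Proof. by move=> p q r; apply: val_inj; congr (_, _) => /=; ring. Qed.

Fact pell_mulC : commutative pell_mul.
Proof. by move=> p q; apply: val_inj; congr (_, _) => /=; ring. Qed.

Fact pell_mul1 : left_id pell_one pell_mul.
Proof. by case=> [[x y] ?]; apply: val_inj; congr (_, _) => /=; ring. Qed.

Fact pell_mulV : left_inverse pell_one pell_inv pell_mul.
Proof.
move=> p; apply: val_inj; congr (_, _) => /=; last ring.
by rewrite -(pellP p) /Q0 -/s -/m; ring.
Qed.

HB.instance Definition _ := @isGroup.Build pell pell_one pell_inv pell_mul
  pell_mulA pell_mul1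
  (fun x => etrans (pell_mulC _ _) (pell_mul1 _)) pell_mulV
  (fun x => etrans (pell_mulC _ _) (pell_mulV _)).
End Pell.

Section PellIncl.
Variable D : int.

Fact pell_incl_subproof (p : pell D int)
  (r := (p.1%:~R, p.2%:~R) : rat * rat) : Q0 D r.1 r.2 == 1.
Proof.
apply/eqP; rewrite -[RHS]/((1 : int)%:~R) -(pellP p) /Q0 /=.
by rewrite !intz; move: (sigma D) (mpar D) => s m; rewrite !(rmorphD, rmorphN, rmorphM, expr2).
Qed.

Definition pell_incl (p : pell D int) : pell D rat :=
  Pell (pell_incl_subproof p).

Fact pell_incl_morph : {morph pell_incl : p q / (p * q)%g}.
Proof.
move=> p q; apply: val_inj; congr (_, _) => /=;
  by rewrite !intz !(rmorphD, rmorphM).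
Qed.

Fact pell_incl1 : pell_incl 1%g = 1%g.
Proof. exact: val_inj. Qed.

HB.instance Definition _ := isUMagmaMorphism.Build _ _ pell_incl
  (pair pell_incl1 pell_incl_morph).
End PellIncl.

Section SetProd.
Variable R : comNzRingType.
Implicit Types I J L S : set R.

(* The additive subgroup generated by the products. *)
Definition ideal_mul I J : set R :=
  [set z | exists2 s : seq (R * R),
     (forall p, p \in s -> I p.1 /\ J p.2) & z = \sum_(p <- s) p.1 * p.2].

Lemma ideal_mul_sub I J S : S 0 -> (forall x y, S x -> S y -> S (x + y)) ->
  (forall x y, I x -> J y -> S (x * y)) -> ideal_mul I J `<=` S.
Proof.
move=> S0 SD SM _ [s sP ->]; rewrite big_seq; elim/big_ind: _ => //.
by move=> p /sP[Ip Jp]; apply: SM.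
Qed.

Lemma ideal_mul0 I J : ideal_mul I J 0.
Proof. by exists [::] => //; rewrite big_nil. Qed.

Lemma ideal_mulD I J x y :
  ideal_mul I J x -> ideal_mul I J y -> ideal_mul I J (x + y).
Proof.
move=> [s sP ->] [t tP ->]; exists (s ++ t); last by rewrite big_cat.
by move=> p; rewrite mem_cat => /orP[/sP|/tP].
Qed.

Lemma mem_ideal_mul I J x y : I x -> J y -> ideal_mul I J (x * y).
Proof.
move=> Ix Jy; exists [:: (x, y)]; last by rewrite big_seq1.
by move=> p; rewrite inE => /eqP->.
Qed.

Lemma ideal_mulZ I J c : (forall x, I x -> I (c * x)) ->
  forall z, ideal_mul I J z -> ideal_mul I J (c * z).
Proof.
move=> Ic; apply: (@ideal_mul_sub I J (fun z => ideal_mul I J (c * z))).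
- by rewrite mulr0; apply: ideal_mul0.
- by move=> x y *; rewrite mulrDr; apply: ideal_mulD.
- by move=> x y Ix Jy; rewrite mulrA; apply: mem_ideal_mul => //; apply: Ic.
Qed.

Lemma ideal_mulC : commutative ideal_mul.
Proof.
suff H I J : ideal_mul I J `<=` ideal_mul J I.
  by move=> I J; apply/seteqP; split; apply: H.
apply: ideal_mul_sub; [exact: ideal_mul0 | exact: ideal_mulD |].
by move=> x y Ix Jy; rewrite mulrC; apply: mem_ideal_mul.
Qed.

Lemma ideal_mulA : associative ideal_mul.
Proof.
have H I J L : ideal_mul I (ideal_mul J L) `<=` ideal_mul (ideal_mul I J) L.
  apply: ideal_mul_sub; [exact: ideal_mul0 | exact: ideal_mulD |].
  move=> x y Ix; move: y.
  apply: (@ideal_mul_sub _ _ (fun y => ideal_mul _ _ (x * y))).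
  - by rewrite mulr0; apply: ideal_mul0.
  - by move=> *; rewrite mulrDr; apply: ideal_mulD.
  - by move=> y z Jy Lz; rewrite mulrA; do 2?apply: mem_ideal_mul.
move=> I J L; apply/seteqP; split; first exact: H.
have := H L J I.
by rewrite (ideal_mulC L (ideal_mul J I)) (ideal_mulC J I)
           (ideal_mulC (ideal_mul L J)) (ideal_mulC L J).
Qed.
End SetProd.
Section Forms.
Variable D : int.
Local Notation s := (sigma D).
Local Notation m := (mpar D).
Local Notation N b := (Q0 D b 1).

(* (A, b) stands for the binary quadratic form
   A^2 t^2 + (2 b + sigma) t u + (Q0(b, 1) / A^2) u^2. *)
Definition form_cond (d : int * int) : bool :=
  (0 < d.1) && (d.1 ^+ 2 %| N d.2)%Z.

Record form_data := FormData { form_val : int * int; _ : form_cond form_val }.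
HB.instance Definition _ := [isSub of form_data for form_val].
HB.instance Definition _ := [Choice of form_data by <:].

Implicit Types d : form_data.
Definition lead d : int := (form_val d).1.
Definition shift d : int := (form_val d).2.

Definition same_class d d' : bool :=
  (lead d == lead d') && (shift d == shift d' %[mod lead d ^+ 2])%Z.

Fact same_class_refl : reflexive same_class.
Proof. by move=> d; rewrite /same_class !eqxx. Qed.

Fact same_class_sym : symmetric same_class.
Proof.
move=> d d'; rewrite /same_class eq_sym; case: eqP => //= ->.
by rewrite eq_sym.
Qed.

Fact same_class_trans : transitive same_class.
Proof.
move=> d' d d''; rewrite /same_class => /andP[/eqP-> /eqP->].
by move=> /andP[/eqP-> /eqP->]; rewrite !eqxx.
Qed.

Definition same_class_equiv :=
  EquivRel same_class same_class_refl same_class_sym same_class_trans.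

Lemma same_classP d d' : reflect
  (lead d = lead d' /\ exists t, shift d - shift d' = t * lead d ^+ 2)
  (same_class d d').
Proof.
rewrite /same_class eqz_mod_dvd; apply: (iffP andP).
  by case=> /eqP E1 /dvdzP E2.
by case=> E1 E2; split; [apply/eqP | apply/dvdzP].
Qed.

(* b1 + b2 + sigma and b1 b2 + m, i.e. the coefficients of
   (b1 + omega)(b2 + omega). *)
Definition shift_plus d1 d2 : int := shift d1 + shift d2 + s.
Definition shift_times d1 d2 : int := shift d1 * shift d2 + m.

(* This is a square when D is fundamental. *)
Definition esq d1 d2 : int :=
  gcdz (gcdz (lead d1 ^+ 2) (lead d2 ^+ 2)) (shift_plus d1 d2).

Definition bezout3 d1 d2 (j k l : int) : Prop :=
  lead d1 ^+ 2 * j + lead d2 ^+ 2 * k + shift_plus d1 d2 * l = esq d1 d2.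

Definition comp_lead d1 d2 : int := (lead d1 * lead d2 %/ esq d1 d2)%Z.

Definition comp_shift d1 d2 (j k l : int) : int :=
  (lead d1 ^+ 2 %/ esq d1 d2)%Z * shift d2 * j
  + (lead d2 ^+ 2 %/ esq d1 d2)%Z * shift d1 * k
  + (shift_times d1 d2 %/ esq d1 d2)%Z * l.

Lemma lead_gt0 d : 0 < lead d. Proof. by case: d => x Px; case/andP: (Px). Qed.

Lemma leadN d : exists q, N (shift d) = q * lead d ^+ 2.
Proof. by case: d => x Px; case/andP: (Px) => _ /dvdzP. Qed.

Record comp_ctx d1 d2 g u1 u2 u3 w q1 q2 := CompCtx {
  ctx_g : 0 < g;
  ctx_u1 : lead d1 ^+ 2 = g * u1;
  ctx_u2 : lead d2 ^+ 2 = g * u2;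
  ctx_u3 : shift_plus d1 d2 = g * u3;
  ctx_w : shift_times d1 d2 = g * w;
  ctx_w1 : w = u3 * shift d2 - u2 * q2;
  ctx_w2 : w = u3 * shift d1 - u1 * q1;
  ctx_q1 : N (shift d1) = q1 * lead d1 ^+ 2;
  ctx_q2 : N (shift d2) = q2 * lead d2 ^+ 2;
  ctx_A : exists2 A3, 0 < A3 & lead d1 * lead d2 = g * A3 /\ A3 ^+ 2 = u1 * u2
}.

Lemma esq_gt0 d1 d2 : 0 < esq d1 d2.
Proof.
rewrite lt_def andbT gcdz_eq0 gcdz_eq0 !expf_eq0 /=.
by rewrite gt_eqF ?lead_gt0.
Qed.

Lemma get_ctx d1 d2 :
  exists u1 u2 u3 w q1 q2, comp_ctx d1 d2 (esq d1 d2) u1 u2 u3 w q1 q2.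
Proof.
set g := esq d1 d2.
have g0 : 0 < g := esq_gt0 d1 d2.
have gn : g != 0 by rewrite gt_eqF.
have [q1 Q1] := leadN d1; have [q2 Q2] := leadN d2.
have gg : (g %| gcdz (lead d1 ^+ 2) (lead d2 ^+ 2))%Z by apply: dvdz_gcdl.
have /dvdzP[u1 U1] : (g %| lead d1 ^+ 2)%Z by apply: dvdz_trans gg (dvdz_gcdl _ _).
have /dvdzP[u2 U2] : (g %| lead d2 ^+ 2)%Z by apply: dvdz_trans gg (dvdz_gcdr _ _).
have /dvdzP[u3 U3] : (g %| shift_plus d1 d2)%Z by apply: dvdz_gcdr.
have /dvdzP[A3 EA] : (g %| lead d1 * lead d2)%Z.
  have : (g ^+ 2 %| (lead d1 * lead d2) ^+ 2)%Z.
    by rewrite exprMn U1 U2; apply/dvdzP; exists (u1 * u2); ring.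
  rewrite !dvdzE !abszX. by rewrite dvdn_pexp2r.
have W : shift_times d1 d2 = g * (u3 * shift d2 - u2 * q2).
  rewrite mulrBr !mulrA [g * u3]mulrC -U3 [g * u2]mulrC -U2 mulrC.
  have -> : lead d2 ^+ 2 * q2 = N (shift d2) by rewrite Q2 mulrC.
  by rewrite /shift_plus /shift_times /Q0 !intz; ring.
have W' : shift_times d1 d2 = g * (u3 * shift d1 - u1 * q1).
  rewrite mulrBr !mulrA [g * u3]mulrC -U3 [g * u1]mulrC -U1 mulrC.
  have -> : lead d1 ^+ 2 * q1 = N (shift d1) by rewrite Q1 mulrC.
  by rewrite /shift_plus /shift_times /Q0 !intz; ring.
exists u1, u2, u3, (u3 * shift d2 - u2 * q2), q1, q2; split => //.
- by rewrite mulrC.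
- by rewrite mulrC.
- by rewrite mulrC.
- by apply: (mulfI gn); rewrite -W W'.
exists A3; first by move: (lead_gt0 d1) (lead_gt0 d2) => *; nia.
split; first by rewrite EA mulrC.
have g2 : g ^+ 2 != 0 by rewrite expf_neq0.
apply: (mulfI g2); rewrite -exprMn [g * A3]mulrC -EA exprMn U1 U2; ring.
Qed.

Lemma comp_shiftE d1 d2 g u1 u2 u3 w q1 q2 j k l :
  comp_ctx d1 d2 g u1 u2 u3 w q1 q2 -> g = esq d1 d2 ->
  comp_shift d1 d2 j k l = u1 * shift d2 * j + u2 * shift d1 * k + w * l.
Proof.
move=> C eg; have gn : g != 0 by rewrite gt_eqF ?(ctx_g C).
by rewrite /comp_shift -eg (ctx_u1 C) (ctx_u2 C) (ctx_w C) !mulKz.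
Qed.

Lemma bezout3E d1 d2 g u1 u2 u3 w q1 q2 j k l :
  comp_ctx d1 d2 g u1 u2 u3 w q1 q2 -> g = esq d1 d2 ->
  bezout3 d1 d2 j k l -> u1 * j + u2 * k + u3 * l = 1.
Proof.
move=> C eg; have gn : g != 0 by rewrite gt_eqF ?(ctx_g C).
rewrite /bezout3 -eg (ctx_u1 C) (ctx_u2 C) (ctx_u3 C) => H.
by apply: (mulfI gn); rewrite mulr1 -[RHS]H; ring.
Qed.

(* These three congruences determine b3 modulo u1 u2 = A3^2. *)
Lemma comp_cong d1 d2 g u1 u2 u3 w q1 q2 j k l
  (b3 := u1 * shift d2 * j + u2 * shift d1 * k + w * l) :
  comp_ctx d1 d2 g u1 u2 u3 w q1 q2 -> u1 * j + u2 * k + u3 * l = 1 ->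
  [/\ exists t, shift d2 - b3 = u2 * t,
      exists t, shift d1 - b3 = u1 * t &
      exists t, w - u3 * b3 = u1 * u2 * t].
Proof.
move=> C B; rewrite /b3; split.
- exists (k * (shift d2 - shift d1) + l * q2).
  rewrite -[X in X - _]mulr1 -[1 in LHS]B (ctx_w1 C); ring.
- exists (j * (shift d1 - shift d2) + l * q1).
  rewrite -[X in X - _]mulr1 -[1 in LHS]B (ctx_w2 C); ring.
- exists (- (j * q2 + k * q1)).
  rewrite -[X in X - _]mulr1 -[1 in LHS]B.
  have -> : w * (u1 * j + u2 * k + u3 * l) =
    (u3 * shift d2 - u2 * q2) * (u1 * j) +
    (u3 * shift d1 - u1 * q1) * (u2 * k) + w * u3 * l.
    by rewrite -(ctx_w1 C) -(ctx_w2 C); ring.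
  ring.
Qed.

Lemma comp_norm d1 d2 g u1 u2 u3 w q1 q2 j k l
  (b3 := u1 * shift d2 * j + u2 * shift d1 * k + w * l) :
  comp_ctx d1 d2 g u1 u2 u3 w q1 q2 -> u1 * j + u2 * k + u3 * l = 1 ->
  exists t, N b3 = t * (u1 * u2).
Proof.
move=> C B; set b1 := shift d1; set b2 := shift d2.
exists (u1 * j ^+ 2 * g * q2 + u2 * k ^+ 2 * g * q1 + l ^+ 2 * q1 * q2
  + j * k * (2 * b1 * b2 + s * (b1 + b2) - 2 * m)
  + j * l * q2 * (2 * b1 + s) + k * l * q1 * (2 * b2 + s)).
have gn : g ^+ 2 != 0 by rewrite expf_neq0 // gt_eqF ?(ctx_g C).
apply: (mulfI gn).
pose X := lead d1 ^+ 2 * j; pose Y := lead d2 ^+ 2 * k.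
pose Z := shift_plus d1 d2.
have E1 : g * b3 = X * b2 + Y * b1 + shift_times d1 d2 * l.
  by rewrite /b3 /X /Y (ctx_u1 C) (ctx_u2 C) (ctx_w C); ring.
have E2 : g = X + Y + Z * l.
  by rewrite /X /Y /Z (ctx_u1 C) (ctx_u2 C) (ctx_u3 C) -[LHS]mulr1 -[1 in LHS]B; ring.
have F1 := ctx_q1 C; have F2 := ctx_q2 C.
have -> : g ^+ 2 * N b3 = N b2 * X ^+ 2 + N b1 * Y ^+ 2
   + l ^+ 2 * N b1 * N b2 + X * Y * (2 * b1 * b2 + s * (b1 + b2) - 2 * m)
   + X * l * N b2 * (2 * b1 + s) + Y * l * N b1 * (2 * b2 + s).
  transitivity ((g * b3) ^+ 2 + s * (g * b3) * g - m * g ^+ 2).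
    by rewrite /Q0 !intz; ring.
  rewrite E1 [in LHS]E2 /Z /shift_plus /shift_times /Q0 !intz -/b1 -/b2; ring.
rewrite F1 F2 /X /Y (ctx_u1 C) (ctx_u2 C); ring.
Qed.

Fact compose_subproof d1 d2 j k l : bezout3 d1 d2 j k l ->
  form_cond (comp_lead d1 d2, comp_shift d1 d2 j k l).
Proof.
move=> B; have [u1 [u2 [u3 [w [q1 [q2 C]]]]]] := get_ctx d1 d2.
have B' := bezout3E C erefl B.
have gn : esq d1 d2 != 0 by rewrite gt_eqF ?(ctx_g C).
rewrite /form_cond /= (comp_shiftE _ _ _ C erefl) /comp_lead.
have [A3 A0 [-> A3E]] := ctx_A C; rewrite mulKz // A0 A3E /=.
by apply/dvdzP; apply: comp_norm C B'.
Qed.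

Definition compose d1 d2 j k l (B : bezout3 d1 d2 j k l) : form_data :=
  FormData (compose_subproof B).

Definition bez_j d1 d2 : int :=
  (egcdz (gcdz (lead d1 ^+ 2) (lead d2 ^+ 2)) (shift_plus d1 d2)).1
  * (egcdz (lead d1 ^+ 2) (lead d2 ^+ 2)).1.
Definition bez_k d1 d2 : int :=
  (egcdz (gcdz (lead d1 ^+ 2) (lead d2 ^+ 2)) (shift_plus d1 d2)).1
  * (egcdz (lead d1 ^+ 2) (lead d2 ^+ 2)).2.
Definition bez_l d1 d2 : int :=
  (egcdz (gcdz (lead d1 ^+ 2) (lead d2 ^+ 2)) (shift_plus d1 d2)).2.

Fact bez_subproof d1 d2 :
  bezout3 d1 d2 (bez_j d1 d2) (bez_k d1 d2) (bez_l d1 d2).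
Proof.
rewrite /bezout3 /esq /bez_j /bez_k /bez_l.
case: (egcdzP (lead d1 ^+ 2) (lead d2 ^+ 2)) => u v E1 _.
case: (egcdzP (gcdz _ _)) => x y E2 _ /=.
by rewrite -E2 -E1; ring.
Qed.

Definition data_mul d1 d2 : form_data := compose (bez_subproof d1 d2).

Lemma gtz_dvd_eq (a b : int) : 0 < a -> 0 < b ->
  (a %| b)%Z -> (b %| a)%Z -> a = b.
Proof.
move=> a0 b0; rewrite !dvdzE => ab ba.
rewrite -[LHS]gtz0_abs // -[RHS]gtz0_abs //; congr Posz.
by apply/eqP; rewrite eqn_dvd ab.
Qed.

Lemma shift_plusE d1 d2 d1' d2' t1 t2 :
  shift d1 - shift d1' = t1 -> shift d2 - shift d2' = t2 ->
  shift_plus d1' d2' = shift_plus d1 d2 - (t1 + t2).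
Proof. by rewrite /shift_plus => <- <-; ring. Qed.

Lemma esq_dvd d1 d2 d1' d2' : same_class d1 d1' -> same_class d2 d2' ->
  (esq d1 d2 %| esq d1' d2')%Z.
Proof.
move=> /same_classP[A1 [t1 T1]] /same_classP[A2 [t2 T2]].
have [u1 [u2 [u3 [w [q1 [q2 C]]]]]] := get_ctx d1 d2.
set g := esq d1 d2 in C *; rewrite /esq !dvdz_gcd -A1 -A2.
rewrite (shift_plusE T1 T2) (ctx_u1 C) (ctx_u2 C) (ctx_u3 C).
apply/andP; split; first by rewrite !dvdz_mulr.
by apply/dvdzP; exists (u3 - (t1 * u1 + t2 * u2)); ring.
Qed.

Lemma esq_class d1 d2 d1' d2' : same_class d1 d1' -> same_class d2 d2' ->
  esq d1' d2' = esq d1 d2.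
Proof.
move=> S1 S2; apply: gtz_dvd_eq; rewrite ?esq_gt0 //.
  by apply: esq_dvd; rewrite same_class_sym.
exact: esq_dvd.
Qed.

Lemma compose_class d1 d2 d1' d2' j k l j' k' l'
    (B : bezout3 d1 d2 j k l) (B' : bezout3 d1' d2' j' k' l') :
  same_class d1 d1' -> same_class d2 d2' ->
  same_class (compose B) (compose B').
Proof.
move=> S1 S2; have eg := esq_class S1 S2.
case/same_classP: S1 => A1 [t1 T1]; case/same_classP: S2 => A2 [t2 T2].
have [u1 [u2 [u3 [w [q1 [q2 C]]]]]] := get_ctx d1 d2.
have [v1 [v2 [v3 [w' [r1 [r2 C']]]]]] := get_ctx d1' d2'.
have b1 := bezout3E C erefl B; have b1' := bezout3E C' erefl B'.
have g0 := ctx_g C; have gn : esq d1 d2 != 0 by rewrite gt_eqF.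
apply/same_classP; split.
  by rewrite /lead /= /comp_lead eg A1 A2.
rewrite /shift /= (comp_shiftE _ _ _ C erefl) (comp_shiftE _ _ _ C' erefl).
have [[x1 X1] [x2 X2] [x3 X3]] := comp_cong C b1.
have [[y1 Y1] [y2 Y2] [y3 Y3]] := comp_cong C' b1'.
move: X1 X2 X3 Y1 Y2 Y3.
set b3 := (u1 * _ * _ + _ + _); set b3' := (v1 * _ * _ + _ + _).
move=> X1 X2 X3 Y1 Y2 Y3.
have V1 : v1 = u1.
  by apply: (mulfI gn); rewrite -(ctx_u1 C) A1 (ctx_u1 C') eg.
have V2 : v2 = u2.
  by apply: (mulfI gn); rewrite -(ctx_u2 C) A2 (ctx_u2 C') eg.
have V3 : v3 = u3 - (t1 * u1 + t2 * u2).
  apply: (mulfI gn); rewrite -{1}eg -(ctx_u3 C') (shift_plusE T1 T2).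
  by rewrite (ctx_u1 C) (ctx_u2 C) (ctx_u3 C); ring.
have W : w' = w - (t1 * u1 * shift d2 + t2 * u2 * shift d1
                   - t1 * t2 * u1 * (esq d1 d2 * u2)).
  apply: (mulfI gn); rewrite -{1}eg -(ctx_w C').
  have E1 : shift d1' = shift d1 - t1 * (esq d1 d2 * u1).
    by rewrite -(ctx_u1 C) -T1; ring.
  have E2 : shift d2' = shift d2 - t2 * (esq d1 d2 * u2).
    by rewrite -(ctx_u2 C) -T2; ring.
  by rewrite mulrBr -(ctx_w C) /shift_times E1 E2; ring.
set g := esq d1 d2 in C gn W T1 T2 *.
have Z1 : shift d2 - b3' = u2 * (g * t2 + y1).
  have -> : shift d2 - b3' = (shift d2 - shift d2') + (shift d2' - b3') by ring.
  by rewrite Y1 T2 (ctx_u2 C) V2; ring.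
have Z2 : shift d1 - b3' = u1 * (g * t1 + y2).
  have -> : shift d1 - b3' = (shift d1 - shift d1') + (shift d1' - b3') by ring.
  by rewrite Y2 T1 (ctx_u1 C) V1; ring.
have Z3 : w - u3 * b3' = u1 * u2 *
  (y3 + t1 * (g * t2 + y1) + t2 * (g * t1 + y2) - t1 * t2 * g).
  have -> : w - u3 * b3' = (w' - v3 * b3') + t1 * u1 * (shift d2 - b3')
     + t2 * u2 * (shift d1 - b3') - t1 * t2 * u1 * (g * u2).
    by rewrite W V3; ring.
  by rewrite Y3 Z1 Z2 V1 V2; ring.
have -> : lead (compose B) ^+ 2 = u1 * u2.
  rewrite /lead /= /comp_lead -/g; have [A3 _ [-> <-]] := ctx_A C.
  by rewrite mulKz.
exists (j * (g * t2 + y1 - x1) + k * (g * t1 + y2 - x2)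
  + l * (y3 + t1 * (g * t2 + y1) + t2 * (g * t1 + y2) - t1 * t2 * g - x3)).
transitivity (u1 * j * ((shift d2 - b3') - (shift d2 - b3))
  + u2 * k * ((shift d1 - b3') - (shift d1 - b3))
  + l * ((w - u3 * b3') - (w - u3 * b3))).
  by rewrite -[LHS]mulr1 -[1 in LHS]b1; ring.
by rewrite Z1 Z2 Z3 X1 X2 X3; ring.
Qed.

Fact one_subproof : form_cond (1, 0).
Proof. by rewrite /form_cond /= expr1n dvd1z. Qed.

Definition data_one : form_data := FormData one_subproof.

Fact inv_subproof d : form_cond (lead d, - shift d - s).
Proof.
rewrite /form_cond /= lead_gt0; apply/dvdzP; have [q E] := leadN d.
exists q; transitivity (N (shift d)); last exact: E.
by rewrite /Q0 !intz; ring.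
Qed.

Definition data_inv d : form_data := FormData (inv_subproof d).

Lemma esqC d1 d2 : esq d1 d2 = esq d2 d1.
Proof.
rewrite /esq [gcdz (lead d1 ^+ 2) _]gcdzC; congr gcdz.
by rewrite /shift_plus; ring.
Qed.

Lemma data_mulC d1 d2 : same_class (data_mul d1 d2) (data_mul d2 d1).
Proof.
have B := bez_subproof d1 d2.
set j := bez_j d1 d2 in B; set k := bez_k d1 d2 in B.
set l := bez_l d1 d2 in B.
have B' : bezout3 d2 d1 k j l.
  by rewrite /bezout3 esqC -[RHS]B /shift_plus; ring.
have E : compose (bez_subproof d1 d2) = compose B'.
  apply: val_inj; rewrite /= /comp_lead /comp_shift [esq d2 d1]esqC.
  rewrite [shift_times d2 d1]/shift_times [shift d2 * _]mulrC.
  rewrite -/(shift_times d1 d2) [lead d2 * _]mulrC -/j -/k -/l; congr pair; ring.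
by rewrite /data_mul E; apply: compose_class; apply: same_class_refl.
Qed.

Lemma data_mul1 d : same_class (data_mul data_one d) d.
Proof.
have e : esq data_one d = 1.
  by rewrite /esq {1}/lead /= expr1n gcd1z gcd1z.
have B : bezout3 data_one d 1 0 0.
  by rewrite /bezout3 e {1}/lead /= expr1n; ring.
have {2}-> : d = compose B.
  apply: val_inj; rewrite /= /comp_lead /comp_shift e !divz1.
  by rewrite {1 2}/lead /= expr1n !mul1r !mulr0 mulr1 !addr0; case: (d) => -[].
by apply: compose_class; apply: same_class_refl.
Qed.

Lemma data_mulV d : same_class (data_mul (data_inv d) d) data_one.
Proof.
have n0 : lead d ^+ 2 != 0 by rewrite expf_neq0 // gt_eqF ?lead_gt0.
have e : esq (data_inv d) d = lead d ^+ 2.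
  rewrite /esq; have -> : shift_plus (data_inv d) d = 0.
    by rewrite /shift_plus {1}/shift /=; ring.
  rewrite {1}/lead /= -/(lead d) gcdz0 gcdzz.
  by rewrite !gez0_abs ?sqr_ge0.
apply/same_classP; rewrite /lead /= /comp_lead e [lead (data_inv d)]/lead /=.
rewrite -expr2 divzz n0; split=> //.
by exists (shift (data_mul (data_inv d) d) - shift data_one);
  rewrite expr1n mulr1.
Qed.

End Forms.

(** Associativity, through the lattices A^2 Z + (b + omega) Z of the ring
    Z[omega], represented by pairs of coordinates on (1, omega). *)
Definition quad (D : int) : Type := (int * int)%type.

Section QuadRing.
Variable D : int.
Local Notation quad := (quad D).

HB.instance Definition _ := GRing.Zmodule.on quad.

Definition quad_mul (x y : quad) : quad :=
  (x.1 * y.1 + mpar D * x.2 * y.2,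
   x.1 * y.2 + x.2 * y.1 + sigma D * x.2 * y.2).

Fact quad_mulA : associative quad_mul.
Proof. by move=> x y z; congr pair => /=; ring. Qed.
Fact quad_mulC : commutative quad_mul.
Proof. by move=> x y; congr pair => /=; ring. Qed.
Fact quad_mul1 : left_id ((1, 0) : quad) quad_mul.
Proof. by case=> x y; congr pair => /=; ring. Qed.
Fact quad_mulD : left_distributive quad_mul +%R.
Proof. by move=> x y z; congr pair => /=; ring. Qed.
Fact quad_one_neq0 : ((1, 0) : quad) != 0. Proof. by []. Qed.

HB.instance Definition _ := GRing.Zmodule_isComNzRing.Build quad
  quad_mulA quad_mulC quad_mul1 quad_mulD quad_one_neq0.

End QuadRing.

Section Lattice.
Variable D : fund_disc.
Local Notation s := (sigma D).
Local Notation m := (mpar D).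
Local Notation N b := (Q0 D b 1).
Implicit Types (d : form_data D) (c : int).

Lemma disc_eq : (D : int) = s + 4 * m.
Proof. by rewrite {1}(divz_eq D 4) mulrC addrC. Qed.

Lemma sigma_sqr : s ^+ 2 = s.
Proof.
rewrite /sigma; case: (discP D) => [[-> _ _] | [n [E _ _]]]; first by rewrite expr1n.
by rewrite E modzMr expr0n.
Qed.

Lemma fundamental_unit (p x y : int) : (D : int) = p ^+ 2 * (x ^+ 2 - 4 * y) ->
  p \is a GRing.unit.
Proof.
case: (discP D) => [[_ sf _] E | [n [Dn n23 sf] E]].
  by apply: sf; apply/dvdzP; eexists; rewrite E mulrC.
have pmod (z : int) : exists t, z = 2 * t \/ z = 2 * t + 1.
  exists (z %/ 2)%Z; have := divz_eq z 2; have := modz_ge0 z (d := 2) isT.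
  have := ltz_pmod z (d := 2) isT; lia.
have [x' [xE | xE]] := pmod x.
  apply: sf; apply/dvdzP; exists (x' ^+ 2 - y).
  by apply: (@mulfI _ (4 : int)) => //; rewrite -Dn E xE; ring.
have [p' [pE | pE]] := pmod p; last by exfalso; rewrite E xE pE in Dn; lia.
have nE : n = (x ^+ 2 - 4 * y) * p' ^+ 2.
  by apply: (@mulfI _ (4 : int)) => //; rewrite -Dn E pE; ring.
have : p' \is a GRing.unit by apply: sf; apply/dvdzP; eexists; exact: nE.
rewrite qualifE /= => /orP p'1.
have {p'1} p2 : p' ^+ 2 = 1 by case: p'1 => /eqP->.
exfalso; have : (n %% 4)%Z = 1.
  have -> : n = (x' ^+ 2 + x' - y) * 4 + 1 by rewrite nE p2 xE; ring.
  by rewrite modzMDl.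
by case: n23 => ->.
Qed.

Definition lat c d : set (quad D) :=
  [set z | exists a b : int,
     z = (c * (a * lead d ^+ 2 + b * shift d), c * b)].

Lemma lat0 c d : lat c d 0.
Proof. by exists 0, 0; congr pair; ring. Qed.

Lemma latD c d x y : lat c d x -> lat c d y -> lat c d (x + y).
Proof.
move=> [a [b ->]] [a' [b' ->]]; exists (a + a'), (b + b').
by congr pair => /=; ring.
Qed.

Lemma latZ c d (k : int) x : lat c d x -> lat c d (((k, 0) : quad D) * x).
Proof.
by move=> [a [b ->]]; exists (k * a), (k * b); congr pair => /=; ring.
Qed.

Lemma lat_class c d d' : same_class d d' -> lat c d = lat c d'.
Proof.
have H e e' : same_class e e' -> lat c e `<=` lat c e'.
  move=> /same_classP[E [t T]] _ [a [b ->]]; exists (a + b * t), b.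
  have -> : shift e = shift e' + t * lead e ^+ 2 by rewrite -T; ring.
  by rewrite E; congr pair; ring.
by move=> S; apply/seteqP; split; apply: H; rewrite // same_class_sym.
Qed.

Lemma lat_inj c c' d d' : 0 < c -> 0 < c' -> lat c d = lat c' d' ->
  same_class d d'.
Proof.
have H e e' a a' : 0 < a -> lat a e = lat a' e' -> (a' %| a)%Z.
  move=> a0 E; have : lat a' e' (a * shift e, a).
    by rewrite -E; exists 0, 1; congr pair; ring.
  by case=> x [y [_ ->]]; apply: dvdz_mulr.
move=> c0 c'0 E; have cE : c = c'.
  by apply: gtz_dvd_eq => //; [apply: H (esym E) | apply: H E].
have cn : c != 0 by rewrite gt_eqF.
have {H}H e e' : lat c e = lat c e' -> (lead e' %| lead e)%Z.
  move=> F; have : lat c e' (c * lead e ^+ 2, 0).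
    by rewrite -F; exists 1, 0; congr pair; ring.
  case=> x [y [F1 /esym/eqP]]; rewrite mulf_eq0 (negPf cn) /= => /eqP y0.
  move: F1; rewrite y0 mul0r addr0 => /(mulfI cn) F1.
  have : (lead e' ^+ 2 %| lead e ^+ 2)%Z by apply/dvdzP; exists x.
  by rewrite !dvdzE !abszX dvdn_pexp2r.
rewrite -cE in E; have lE : lead d = lead d'.
  by apply: gtz_dvd_eq; rewrite ?lead_gt0 //; [apply: H (esym E) | apply: H E].
apply/same_classP; split=> //.
have : lat c d' (c * shift d, c).
  by rewrite -E; exists 0, 1; congr pair; ring.
case=> x [y [F1 F2]]; have y1 : y = 1 by apply: (mulfI cn); rewrite mulr1.
exists x; move: F1; rewrite y1 => /(mulfI cn) ->; rewrite lE; ring.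
Qed.

Lemma coprime_ctx d1 d2 g u1 u2 u3 w q1 q2 :
  comp_ctx d1 d2 g u1 u2 u3 w q1 q2 ->
  exists x y z t : int, x * (shift d1 - shift d2) + y * q2 + z * q1 + t * g = 1.
Proof.
move=> C; set h1 := gcdz (shift d1 - shift d2) q2.
set h2 := gcdz q1 g; set h := gcdz h1 h2.
have h2_neq0 : h2 != 0 by rewrite gcdz_eq0 negb_and orbC gt_eqF ?(ctx_g C).
have h_neq0 : h != 0 by rewrite gcdz_eq0 negb_and h2_neq0 orbT.
suff h1E : h = 1.
  have [x [y Exy]] := Bezoutz (shift d1 - shift d2) q2.
  have [z [t Ezt]] := Bezoutz q1 g.
  have [u [v Euv]] := Bezoutz h1 h2.
  exists (u * x), (u * y), (v * z), (v * t).
  by rewrite -h1E /h -Euv /h1 /h2 -Exy -Ezt; ring.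
have hn : (0 < `|h|)%N by rewrite absz_gt0.
have habs : h = `|h|%N by rewrite gez0_abs.
suff : `|h|%N == 1%N by move/eqP=> E; rewrite habs E.
apply/negPn/negP => hne1.
have hgt1 : (1 < `|h|)%N by rewrite ltn_neqAle eq_sym hne1.
have pp := pdiv_prime hgt1; set p := pdiv _ in pp.
have ph : (p%:Z %| h)%Z by rewrite dvdzE /= pdiv_dvd.
have ph1 := dvdz_trans ph (dvdz_gcdl _ _).
have ph2 := dvdz_trans ph (dvdz_gcdr _ _).
have /dvdzP[x X] := dvdz_trans ph1 (dvdz_gcdl _ _).
have /dvdzP[y Y] := dvdz_trans ph2 (dvdz_gcdr _ _).
have pA : (p%:Z %| lead d1)%Z.
  have : (p%:Z %| lead d1 ^+ 2)%Z.
    by rewrite (ctx_u1 C) Y; apply/dvdzP; exists (y * u1); ring.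
  by rewrite !dvdzE abszX Euclid_dvdX // => /andP[].
have /dvdzP[A AE] := pA.
have : p%:Z \is a GRing.unit.
  apply: (@fundamental_unit _ (x + y * u3) (q1 * A ^+ 2)).
  have F : 2 * shift d1 + s = p%:Z * (x + y * u3).
    transitivity ((shift d1 - shift d2) + shift_plus d1 d2).
      by rewrite /shift_plus; ring.
    by rewrite X (ctx_u3 C) Y; ring.
  rewrite disc_eq.
  transitivity ((2 * shift d1 + s) ^+ 2 - 4 * N (shift d1)).
    by rewrite -{1}sigma_sqr /Q0 !intz; ring.
  by rewrite F (ctx_q1 C) AE; ring.
rewrite qualifE /= => /orP[] /eqP E; last by [].
by move: pp; case: E => ->.
Qed.

Lemma lat_mul c1 c2 d1 d2 :
  ideal_mul (lat c1 d1) (lat c2 d2) =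
  lat (c1 * c2 * esq d1 d2) (data_mul d1 d2).
Proof.
have [u1 [u2 [u3 [w [q1 [q2 C]]]]]] := get_ctx d1 d2.
have B := bezout3E C erefl (bez_subproof d1 d2).
have [[x1 X1] [x2 X2] [x3 X3]] := comp_cong C B.
have [y1 [y2 [y3 [y4 Y]]]] := coprime_ctx C.
have n3E : lead (data_mul d1 d2) ^+ 2 = u1 * u2.
  rewrite /lead /= /comp_lead; have [A3 _ [-> <-]] := ctx_A C.
  by rewrite mulKz // gt_eqF ?(ctx_g C).
have b3E := comp_shiftE (bez_j d1 d2) (bez_k d1 d2) (bez_l d1 d2) C erefl.
move: X1 X2 X3; rewrite -b3E -/(shift (data_mul d1 d2)).
rewrite -[comp_shift _ _ _ _ _]/(shift (data_mul d1 d2)).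
set b3 := shift (data_mul d1 d2); set g := esq d1 d2 => X1 X2 X3.
have U1 := ctx_u1 C; have U2 := ctx_u2 C; rewrite -/g in U1 U2.
have U3 := ctx_u3 C; have W := ctx_w C; rewrite -/g in U3 W.
apply/seteqP; split.
  apply: ideal_mul_sub; [exact: lat0 | exact: latD |].
  move=> _ _ [a [b ->]] [a' [b' ->]].
  exists (a * a' * g + a * b' * x1 + b * a' * x2 + b * b' * x3),
         (a * b' * u1 + b * a' * u2 + b * b' * u3).
  rewrite n3E -/b3; congr pair => /=.
    transitivity (c1 * c2 * (a * a' * (lead d1 ^+ 2) * (lead d2 ^+ 2)
      + a * b' * (lead d1 ^+ 2) * shift d2 + b * a' * (lead d2 ^+ 2) * shift d1
      + b * b' * shift_times d1 d2)).
      by rewrite /shift_times; ring.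
    rewrite U1 U2 W.
    have -> : shift d2 = b3 + u2 * x1 by rewrite -X1; ring.
    have -> : shift d1 = b3 + u1 * x2 by rewrite -X2; ring.
    have -> : w = u3 * b3 + u1 * u2 * x3 by rewrite -X3; ring.
    by ring.
  transitivity (c1 * c2 * (a * b' * (lead d1 ^+ 2) + b * a' * (lead d2 ^+ 2)
      + b * b' * shift_plus d1 d2)).
    by rewrite /shift_plus; ring.
  by rewrite U1 U2 U3; ring.
set P := ideal_mul _ _.
have PZ (k : int) z : P z -> P (((k, 0) : quad D) * z).
  by apply: ideal_mulZ => x; apply: latZ.
have PD z t : P z -> P t -> P (z + t) by apply: ideal_mulD.
have Pprod a b a' b' : P (((c1 * (a * lead d1 ^+ 2 + b * shift d1), c1 * b) : quad D)
    * ((c2 * (a' * lead d2 ^+ 2 + b' * shift d2), c2 * b') : quad D)).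
  by apply: mem_ideal_mul; [exists a, b | exists a', b'].
set c := c1 * c2.
have G0 : P (c * (g ^+ 2 * u1 * u2), 0).
  have := Pprod 1 0 1 0; congr P; congr pair => /=; last ring.
  by rewrite U1 U2 /c; ring.
have G1 : P (c * (g * u1 * shift d2), c * (g * u1)).
  by have := Pprod 1 0 0 1; congr P; congr pair => /=; rewrite -U1 /c; ring.
have G2 : P (c * (g * u2 * shift d1), c * (g * u2)).
  by have := Pprod 0 1 1 0; congr P; congr pair => /=; rewrite -U2 /c; ring.
have G3 : P (c * (g * w), c * (g * u3)).
  have := Pprod 0 1 0 1; congr P; congr pair => /=; rewrite -?W -?U3 /c.
    by rewrite /shift_times; ring.
  by rewrite /shift_plus; ring.
have PC k0 k1 k2 k3 : P (c * (k0 * (g ^+ 2 * u1 * u2) + k1 * (g * u1 * shift d2)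
      + k2 * (g * u2 * shift d1) + k3 * (g * w)),
      c * (k1 * (g * u1) + k2 * (g * u2) + k3 * (g * u3))).
  have := PD _ _ (PD _ _ (PZ k0 _ G0) (PZ k1 _ G1))
                 (PD _ _ (PZ k2 _ G2) (PZ k3 _ G3)).
  by congr P; congr pair => /=; ring.
have H1 : P (c * (g * (u1 * u2)), 0).
  have := PC y4 (- y1 * u2 + y2 * u3) (y1 * u1 + y3 * u3) (- y2 * u1 - y3 * u2).
  congr P; congr pair; last by ring.
  rewrite -[RHS]mulr1 -Y; transitivity
    (c * (y4 * (g ^+ 2 * u1 * u2) + y1 * g * u1 * u2 * (shift d1 - shift d2)
     + y2 * g * u1 * (u3 * shift d2 - w) + y3 * g * u2 * (u3 * shift d1 - w)));
    first by ring.
  by rewrite {1}(ctx_w1 C) (ctx_w2 C); ring.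
have H2 : P (c * (g * b3), c * g).
  have := PC 0 (bez_j d1 d2) (bez_k d1 d2) (bez_l d1 d2).
  congr P; congr pair; last first.
    by rewrite -[in RHS](mulr1 g) -[1 in RHS]B; ring.
  by rewrite -[b3]/(comp_shift _ _ _ _ _) b3E; ring.
move=> _ [a [b ->]]; have := PD _ _ (PZ a _ H1) (PZ b _ H2).
by rewrite n3E -/b3 -/g; congr P; congr pair => /=; rewrite /c; ring.
Qed.

Lemma data_mulA d1 d2 d3 :
  same_class (data_mul d1 (data_mul d2 d3)) (data_mul (data_mul d1 d2) d3).
Proof.
apply: (@lat_inj (esq d2 d3 * esq d1 (data_mul d2 d3))
                 (esq d1 d2 * esq (data_mul d1 d2) d3)).
- by rewrite mulr_gt0 ?esq_gt0.
- by rewrite mulr_gt0 ?esq_gt0.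
have := ideal_mulA (lat 1 d1) (lat 1 d2) (lat 1 d3).
by rewrite !lat_mul !mul1r mulr1.
Qed.

End Lattice.

Section F2.
Variable D : fund_disc.

Definition F2 : Type := {eq_quot (same_class_equiv D)}.
HB.instance Definition _ := Choice.on F2.

Definition form_class (d : form_data D) : F2 := \pi_({eq_quot (same_class_equiv D)}) d.

Lemma form_classP (d d' : form_data D) :
  reflect (form_class d = form_class d') (same_class d d').
Proof. by rewrite -[same_class _ _]/(same_class_equiv D d d'); apply: eqmodP. Qed.

Lemma form_class_surj (f : F2) : exists d, f = form_class d.
Proof. by exists (repr f); rewrite /form_class reprK. Qed.

Definition F2_one : F2 := form_class (data_one D).
Definition F2_inv (f : F2) : F2 := form_class (data_inv (repr f)).
Definition F2_mul (f h : F2) : F2 := form_class (data_mul (repr f) (repr h)).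

Lemma same_class_repr d : same_class (repr (form_class d)) d.
Proof. by apply/form_classP; rewrite /form_class reprK. Qed.

(* The law does not depend on the choice of j, k, l. *)
Lemma F2_mulE d1 d2 j k l (B : bezout3 d1 d2 j k l) :
  F2_mul (form_class d1) (form_class d2) = form_class (compose B).
Proof. by apply/form_classP/compose_class; apply: same_class_repr. Qed.

Lemma F2_mul_class d1 d2 :
  F2_mul (form_class d1) (form_class d2) = form_class (data_mul d1 d2).
Proof. exact: F2_mulE. Qed.

Fact F2_mulA : associative F2_mul.
Proof.
move=> f1 f2 f3; have [d1 ->] := form_class_surj f1.
have [d2 ->] := form_class_surj f2; have [d3 ->] := form_class_surj f3.
by rewrite !F2_mul_class; apply/form_classP/data_mulA.
Qed.

Fact F2_mulC : commutative F2_mul.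
Proof.
move=> f1 f2; have [d1 ->] := form_class_surj f1.
have [d2 ->] := form_class_surj f2.
by rewrite !F2_mul_class; apply/form_classP/data_mulC.
Qed.

Fact F2_mul1 : left_id F2_one F2_mul.
Proof.
move=> f1; have [d1 ->] := form_class_surj f1.
by rewrite F2_mul_class; apply/form_classP/data_mul1.
Qed.

Fact F2_mulV : left_inverse F2_one F2_inv F2_mul.
Proof.
move=> f; rewrite -{2}[f]reprK -/(form_class (repr f)) F2_mul_class.
by apply/form_classP/data_mulV.
Qed.

HB.instance Definition _ := @isGroup.Build F2 F2_one F2_inv F2_mul
  F2_mulA F2_mul1
  (fun x => etrans (F2_mulC _ _) (F2_mul1 _)) F2_mulV
  (fun x => etrans (F2_mulC _ _) (F2_mulV _)).
End F2.

Section NarrowClassGroup.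
Variable K : fieldExtType rat.
Implicit Types (x y a : K) (I J : set K).

Definition integers : set K := [set x | integralOver (intr : int -> K) x].

Lemma integers1 : integers 1. Proof. exact: integral1. Qed.
Lemma integers0 : integers 0. Proof. exact: integral0. Qed.
Lemma integersD x y : integers x -> integers y -> integers (x + y).
Proof. exact: integral_add. Qed.
Lemma integersM x y : integers x -> integers y -> integers (x * y).
Proof. exact: integral_mul. Qed.

Definition fractional_ideal I : Prop :=
  [/\ forall x y, I x -> I y -> I (x + y),
      forall a x, integers a -> I x -> I (a * x),
      exists2 x, I x & x != 0 &
      exists2 d, integers d /\ d != 0 & forall x, I x -> integers (d * x)].

Definition invertible I : Prop :=
  exists2 J, fractional_ideal J & ideal_mul I J = integers.

(* The integers of K form a Dedekind ring, so that every fractional ideal is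
   in fact invertible. *)
Record inv_ideal := InvIdeal {
  ideal_set :> set K;
  _ : `[< fractional_ideal ideal_set /\ invertible ideal_set >]
}.
HB.instance Definition _ := [isSub of inv_ideal for ideal_set].
HB.instance Definition _ := [Choice of inv_ideal by <:].

Implicit Types A B : inv_ideal.

Lemma frac_idealP A : fractional_ideal A.
Proof. by case: A => I IP /=; case/asboolP: (IP). Qed.

Lemma invertibleP A : invertible A.
Proof. by case: A => I IP /=; case/asboolP: (IP). Qed.

Lemma integers_frac : fractional_ideal integers.
Proof.
split; [exact: integersD | exact: integersM | |].
  by exists 1; [exact: integers1 | exact: oner_neq0].
exists 1; first by split; [exact: integers1 | exact: oner_neq0].
by move=> x; rewrite mul1r.
Qed.

Lemma frac_ideal0 I : fractional_ideal I -> I 0.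
Proof.
by case=> _ IM [x Ix _] _; rewrite -(mul0r x); apply: IM; first exact: integers0.
Qed.

Lemma ideal_mul_integers I : fractional_ideal I -> ideal_mul integers I = I.
Proof.
move=> FI; have [ID IM _ _] := FI; apply/seteqP; split.
  by apply: ideal_mul_sub => //; apply: frac_ideal0.
by move=> x Ix; rewrite -(mul1r x); apply: mem_ideal_mul; first exact: integers1.
Qed.

Lemma ideal_mul_frac I J : fractional_ideal I -> fractional_ideal J ->
  fractional_ideal (ideal_mul I J).
Proof.
move=> [ID IM [x Ix x0] [d [Od d0] dI]] [JD JM [y Jy y0] [e [Oe e0] eJ]].
split; first exact: ideal_mulD.
- by move=> a z Oa; apply: ideal_mulZ => t; apply: IM.
- by exists (x * y); [apply: mem_ideal_mul | rewrite mulf_neq0].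
exists (d * e); first by split; [exact: integersM | rewrite mulf_neq0].
apply: (@ideal_mul_sub _ _ _ (fun z => integers (d * e * z))).
- by rewrite mulr0; apply: integers0.
- by move=> z t *; rewrite mulrDr; apply: integersD.
- by move=> z t Iz Jt; rewrite mulrACA; apply: integersM; [apply: dI | apply: eJ].
Qed.

Fact ideal_one_subproof :
  `[< fractional_ideal integers /\ invertible integers >].
Proof.
apply/asboolP; split; first exact: integers_frac.
exists integers; first exact: integers_frac.
exact/ideal_mul_integers/integers_frac.
Qed.

Fact ideal_mul_subproof A B :
  `[< fractional_ideal (ideal_mul A B) /\ invertible (ideal_mul A B) >].
Proof.
apply/asboolP; split; first by apply: ideal_mul_frac; apply: frac_idealP.
have [J FJ AJ] := invertibleP A; have [L FL BL] := invertibleP B.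
exists (ideal_mul J L); first exact: ideal_mul_frac.
rewrite ideal_mulA -(ideal_mulA A) (ideal_mulC B J) (ideal_mulA A) AJ.
by rewrite -ideal_mulA BL ideal_mul_integers //; apply: integers_frac.
Qed.

Fact ideal_inv_subproof A (J := s2val (cid2 (invertibleP A))) :
  `[< fractional_ideal J /\ invertible J >].
Proof.
rewrite /J; case: cid2 => L FL AL /=; apply/asboolP; split => //.
by exists A; [exact: frac_idealP | rewrite ideal_mulC].
Qed.

Definition inv_ideal_one : inv_ideal := InvIdeal ideal_one_subproof.
Definition inv_ideal_mul A B : inv_ideal := InvIdeal (ideal_mul_subproof A B).
Definition inv_ideal_inv A : inv_ideal := InvIdeal (ideal_inv_subproof A).

Fact inv_ideal_mulA : associative inv_ideal_mul.
Proof. by move=> A B C; apply: val_inj; apply: ideal_mulA. Qed.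
Fact inv_ideal_mulC : commutative inv_ideal_mul.
Proof. by move=> A B; apply: val_inj; apply: ideal_mulC. Qed.
Fact inv_ideal_mul1 : left_id inv_ideal_one inv_ideal_mul.
Proof.
by move=> A; apply: val_inj; apply/ideal_mul_integers/frac_idealP.
Qed.
Fact inv_ideal_mulV : left_inverse inv_ideal_one inv_ideal_inv inv_ideal_mul.
Proof.
move=> A; apply: val_inj; rewrite /= ideal_mulC.
by case: cid2.
Qed.

HB.instance Definition _ := @isGroup.Build inv_ideal
  inv_ideal_one inv_ideal_inv inv_ideal_mul inv_ideal_mulA inv_ideal_mul1
  (fun _ => etrans (inv_ideal_mulC _ _) (inv_ideal_mul1 _)) inv_ideal_mulV
  (fun _ => etrans (inv_ideal_mulC _ _) (inv_ideal_mulV _)).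

(* Positive under every real embedding. *)
Definition totally_positive (a : K) : Prop :=
  a != 0 /\ forall f : {rmorphism K -> algC},
    (forall x, f x \is Num.real) -> 0 < f a.

Lemma totally_positive1 : totally_positive 1.
Proof. by split=> [|f _]; [exact: oner_neq0 | rewrite rmorph1]. Qed.

Lemma totally_positiveM a b :
  totally_positive a -> totally_positive b -> totally_positive (a * b).
Proof.
move=> [a0 pa] [b0 pb]; split=> [|f fR]; first by rewrite mulf_neq0.
by rewrite rmorphM mulr_gt0 ?pa ?pb.
Qed.

Lemma totally_positiveV a : totally_positive a -> totally_positive a^-1.
Proof.
move=> [a0 pa]; split=> [|f fR]; first by rewrite invr_eq0.
by rewrite fmorphV invr_gt0 pa.
Qed.

Definition scale a I : set K := [set x | exists2 y, I y & x = a * y].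

Definition narrow_equiv A B : bool :=
  `[< exists2 a, totally_positive a & B = scale a A :> set K >].

Lemma scale1 I : scale 1 I = I.
Proof.
apply/seteqP; split=> x; first by case=> y Iy ->; rewrite mul1r.
by exists x; rewrite ?mul1r.
Qed.

Lemma scaleM a b I : scale a (scale b I) = scale (a * b) I.
Proof.
apply/seteqP; split=> x.
  by case=> _ [y Iy ->] ->; exists y; rewrite ?mulrA.
by case=> y Iy ->; exists (b * y); [exists y | rewrite mulrA].
Qed.

Lemma scale_mul a b I J :
  ideal_mul (scale a I) (scale b J) = scale (a * b) (ideal_mul I J).
Proof.
apply/seteqP; split.
  apply: ideal_mul_sub.
  - by exists 0; [exact: ideal_mul0 | rewrite mulr0].
  - move=> _ _ [x Ix ->] [y Iy ->]; exists (x + y); last by rewrite mulrDr.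
    exact: ideal_mulD.
  - move=> _ _ [x Ix ->] [y Jy ->]; exists (x * y); last by rewrite mulrACA.
    exact: mem_ideal_mul.
move=> _ [z + ->]; move: z.
apply: (@ideal_mul_sub _ _ _ (fun z => ideal_mul _ _ (a * b * z))).
- by rewrite mulr0; apply: ideal_mul0.
- by move=> *; rewrite mulrDr; apply: ideal_mulD.
- move=> x y Ix Jy; rewrite mulrACA.
  by apply: mem_ideal_mul; [exists x | exists y].
Qed.

Fact narrow_equiv_refl : reflexive narrow_equiv.
Proof.
by move=> A; apply/asboolP; exists 1; rewrite ?scale1 //; apply: totally_positive1.
Qed.

Fact narrow_equiv_sym : symmetric narrow_equiv.
Proof.
suff H A B : narrow_equiv A B -> narrow_equiv B A.
  by move=> A B; apply/idP/idP; apply: H.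
move=> /asboolP[a pa E]; apply/asboolP; exists a^-1; first exact: totally_positiveV.
by rewrite E scaleM mulVf ?scale1 //; case: pa.
Qed.

Fact narrow_equiv_trans : transitive narrow_equiv.
Proof.
move=> B A C /asboolP[a pa E] /asboolP[b pb F]; apply/asboolP.
exists (b * a); first exact: totally_positiveM.
by rewrite F E scaleM.
Qed.

Definition narrow_equiv_rel := EquivRel narrow_equiv
  narrow_equiv_refl narrow_equiv_sym narrow_equiv_trans.

Definition narrow_class_group : Type := {eq_quot narrow_equiv_rel}.
HB.instance Definition _ := Choice.on narrow_class_group.

Definition narrow_class A : narrow_class_group :=
  \pi_({eq_quot narrow_equiv_rel}) A.

Lemma narrow_classP A B :
  reflect (narrow_class A = narrow_class B) (narrow_equiv A B).
Proof. by rewrite -[narrow_equiv _ _]/(narrow_equiv_rel A B); apply: eqmodP. Qed.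

Implicit Types c : narrow_class_group.

Lemma narrow_class_surj c : exists A, c = narrow_class A.
Proof. by exists (repr c); rewrite /narrow_class reprK. Qed.

Definition class_one : narrow_class_group := narrow_class 1%g.
Definition class_inv c : narrow_class_group := narrow_class (repr c)^-1%g.
Definition class_mul c c' : narrow_class_group :=
  narrow_class (repr c * repr c')%g.

Lemma class_mulE A B :
  class_mul (narrow_class A) (narrow_class B) = narrow_class (A * B)%g.
Proof.
have reprE C : narrow_equiv (repr (narrow_class C)) C.
  by apply/narrow_classP; rewrite /narrow_class reprK.
apply/narrow_classP; move: (reprE A) (reprE B).
move=> /asboolP[a pa E] /asboolP[b pb F]; apply/asboolP; exists (a * b).
  exact: totally_positiveM.
by rewrite -scale_mul -E -F.
Qed.

Fact class_mulA : associative class_mul.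
Proof.
move=> a b c; have [A ->] := narrow_class_surj a.
have [B ->] := narrow_class_surj b; have [C ->] := narrow_class_surj c.
by rewrite !class_mulE mulgA.
Qed.

Fact class_mulC : commutative class_mul.
Proof.
move=> a b; have [A ->] := narrow_class_surj a.
have [B ->] := narrow_class_surj b.
by rewrite !class_mulE; congr narrow_class; apply: inv_ideal_mulC.
Qed.

Fact class_mul1 : left_id class_one class_mul.
Proof. by move=> a; have [A ->] := narrow_class_surj a; rewrite class_mulE mul1g. Qed.

Fact class_mulV : left_inverse class_one class_inv class_mul.
Proof.
move=> a; rewrite -{2}[a]reprK -/(narrow_class (repr a)) class_mulE.
by rewrite mulVg.
Qed.

HB.instance Definition _ := @isGroup.Build narrow_class_group
  class_one class_inv class_mul class_mulA class_mul1
  (fun _ => etrans (class_mulC _ _) (class_mul1 _)) class_mulV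
  (fun _ => etrans (class_mulC _ _) (class_mulV _)).

End NarrowClassGroup.

Section Maps.
Variable D : fund_disc.

Definition denominator (p : pell D rat) : int := denq p.2.

Definition least_inverse_mod (n v a : int) : Prop :=
  [/\ 0 < a, (a * v = 1 %[mod n])%Z &
      forall a' : int, 0 < a' -> (a' * v = 1 %[mod n])%Z -> a <= a'].

(* With A = denominator p, the integer to be inverted modulo A^2 is A * y:
   it is prime to A, whereas A^2 * y is divisible by A. As Q0(x, y) = 1, A * x
   is an integer too, so that b = a * (A * x), i.e. x / y modulo A^2. *)
Definition is_ratio (p : pell D rat) (beta : int) : Prop :=
  let A := denominator p in
  exists2 b : int,
    if p.2 == 0 then b = 0 else
      exists a u v : int,
        [/\ u%:~R = A%:~R * p.1, v%:~R = A%:~R * p.2,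
            least_inverse_mod (A ^+ 2) v a & b = a * u] &
    beta = (b %% A ^+ 2)%Z.

Definition omega (K : fieldExtType rat) (sqrtD : K) : K :=
  ((sigma D)%:~R + sqrtD) / 2.

Definition form_ideal (K : fieldExtType rat) (sqrtD : K) (d : form_data D) :
    set K :=
  [set x | exists i j : int,
     x = i%:~R * (lead d)%:~R + j%:~R * ((shift d)%:~R + omega sqrtD)].

End Maps.

Definition kernel (G H : groupType) (f : G -> H) : set G :=
  [set x | f x = 1%g].

Definition squares (G : groupType) : set G :=
  [set x | exists y : G, x = (y ^+ 2)%g].

(* Main.v *)
(* Write phi for the embedding (a, b) |-> a + b omega of Z^2 (the type [quad D])
   into K, and L(A, b) for the lattice A^2 Z + (b + omega) Z of Z[omega].
   If (x, y) is a rational point with denominator A and ratio b, then L(A, b) is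
   the principal ideal generated by A (x + y omega), of norm A^2. Since
   L(A1, b1) L(A2, b2) = e^2 L(A3, b3), this makes theta a morphism. As moreover
   L(A, b) is the square of the ideal A Z + (b + omega) Z, the class of that
   square is the narrow class of L(A, b), and rho is a morphism.
   Kernel of rho: if L(A, b) = z Z[omega] with z totally positive, comparing with
   the conjugate lattice gives N z = A^2, so z / A is a rational point.
   Image of rho: an arbitrary ideal is a rational multiple of some
   A Z + (B + omega) Z with A | N(B + omega), whose square is e L(A / e, b) with
   e = gcd(A, 2 B + sigma), by Dirichlet composition. *)

Require Import Defs.
From HB Require Import structures.
From mathcomp Require Import all_boot all_order all_algebra all_field.
From mathcomp Require Import boolp classical_sets.
From mathcomp Require Import ring zify.

Set Implicit Arguments.
Unset Strict Implicit.
Unset Printing Implicit Defensive.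

Import Order.TTheory GRing.Theory Num.Theory.
Local Open Scope ring_scope.
Local Open Scope classical_set_scope.

(* Stands in for a linear-combination tactic: [ring] proves the second premise. *)
Lemma eq_lincomb (a b k c d : int) : c = d -> a - b = k * (c - d) -> a = b.
Proof. by move=> -> /eqP; rewrite subrr mulr0 subr_eq0 => /eqP. Qed.

(** * Lattices in Z[omega] *)

Section QuadOrder.
Variable D : fund_disc.
Local Notation s := (sigma D).
Local Notation m := (mpar D).
Local Notation N := (Q0 D).
Implicit Types (z : quad D) (d : form_data D).

(** If b were nonzero, D would be a square t^2; [fundamental_unit] with x = 1, y = 0 then makes t a
    unit, so D = 1, which no fundamental discriminant is. *)
Lemma disc_nonsquare (b c : int) : (D : int) * b ^+ 2 = c ^+ 2 -> b = 0.
Proof.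
move=> E; apply/eqP/negPn/negP => b0.
have /dvdzP[t tE] : (b %| c)%Z.
  have : (b ^+ 2 %| c ^+ 2)%Z by rewrite -E dvdz_mull.
  by rewrite !dvdzE !abszX dvdn_pexp2r.
have DE : (D : int) = t ^+ 2.
  by apply: (mulIf (expf_neq0 2 b0)); rewrite E tE exprMn.
have tu : t \is a GRing.unit.
  by apply: (@fundamental_unit D t 1 0); rewrite DE; ring.
have D1 : (D : int) = 1.
  by rewrite DE; move: tu; rewrite qualifE /= => /orP[]/eqP->.
case: (discP D) => [[_ _ //] | [n [nE _ _]]].
by move: D1; rewrite nE; lia.
Qed.

Lemma Q0_mul4 (x y : int) :
  4 * N x y = (2 * x + s * y) ^+ 2 - (D : int) * y ^+ 2.
Proof.
rewrite [X in _ - X * _]disc_eq -[X in X + 4 * _](sigma_sqr D) /Q0 !intz; ring.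
Qed.

(** The norm form is anisotropic: complete the square and use that D is not a square. *)
Lemma Q0_eq0 (x y : int) : N x y = 0 -> x = 0 /\ y = 0.
Proof.
move=> E; have := Q0_mul4 x y; rewrite E mulr0 => /esym/eqP.
rewrite subr_eq0 => /eqP/esym E'; have y0 := disc_nonsquare E'.
split=> //; move: E; rewrite y0 /Q0 !intz => E.
by apply/eqP; rewrite -sqrf_eq0 -[X in _ == X]E; apply/eqP; ring.
Qed.

Definition qint (k : int) : quad D := (k, 0).
(** Galois conjugation, which sends omega to sigma - omega. *)
Definition qconj z : quad D := (z.1 + s * z.2, - z.2).

Lemma mul_qconj z : z * qconj z = qint (N z.1 z.2).
Proof. by congr pair; rewrite /Q0 /= ?intz; ring. Qed.

Lemma qconjM : {morph qconj : z z' / z * z'}.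
Proof.
move=> z z'; congr pair => /=; last by ring.
by ring.
Qed.

Lemma qintM (k l : int) : qint (k * l) = qint k * qint l.
Proof. by congr pair => /=; ring. Qed.

Definition dilate z (I : set (quad D)) : set (quad D) :=
  [set x | exists2 y, I y & x = z * y].

(** The lattice A Z + (B + omega) Z in coordinates on 1, omega. *)
Definition olat (A B : int) : set (quad D) :=
  [set z | exists a b : int, z = (a * A + b * B, b)].

Lemma dilateM z z' I : dilate z (dilate z' I) = dilate (z * z') I.
Proof.
apply/seteqP; split=> [x [_ [y Iy ->] ->]|x [y Iy ->]].
  by exists y; rewrite ?mulrA.
by exists (z' * y); [exists y | rewrite mulrA].
Qed.

Lemma dilate_mul z z' (I J : set (quad D)) :
  ideal_mul (dilate z I) (dilate z' J) = dilate (z * z') (ideal_mul I J).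
Proof.
apply/seteqP; split.
  apply: ideal_mul_sub.
  - by exists 0; [exact: ideal_mul0 | rewrite mulr0].
  - move=> _ _ [x Ix ->] [y Iy ->]; exists (x + y); last by rewrite mulrDr.
    exact: ideal_mulD.
  - move=> _ _ [x Ix ->] [y Jy ->]; exists (x * y); last by rewrite mulrACA.
    exact: mem_ideal_mul.
move=> _ [t + ->]; move: t.
apply: (@ideal_mul_sub _ _ _ (fun t => ideal_mul _ _ (z * z' * t))).
- by rewrite mulr0; apply: ideal_mul0.
- by move=> *; rewrite mulrDr; apply: ideal_mulD.
- move=> x y Ix Jy; rewrite mulrACA.
  by apply: mem_ideal_mul; [exists x | exists y].
Qed.

Lemma ideal_mul_setT : ideal_mul [set: quad D] setT = setT.
Proof.
by apply/seteqP; split=> // z _; rewrite -[z]mulr1; apply: mem_ideal_mul.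
Qed.

Lemma latE c d : lat c d = dilate (qint c) (olat (lead d ^+ 2) (shift d)).
Proof.
apply/seteqP; split=> [z [a [b ->]]|_ [_ [a [b ->]] ->]].
  by exists (a * lead d ^+ 2 + b * shift d, b);
    [exists a, b | congr pair => /=; ring].
by exists a, b; congr pair => /=; ring.
Qed.

Lemma dilate1 I : dilate 1 I = I.
Proof.
by apply/seteqP; split=> [_ [y Iy ->]|y Iy]; [rewrite mul1r | exists y; rewrite ?mul1r].
Qed.

Lemma lat1E d : lat 1 d = olat (lead d ^+ 2) (shift d).
Proof. by rewrite latE -[qint 1]/(1 : quad D) dilate1. Qed.

Lemma lat_dilate c c' d : lat (c * c') d = dilate (qint c) (lat c' d).
Proof. by rewrite !latE dilateM -qintM. Qed.

Lemma olatD A B z z' : olat A B z -> olat A B z' -> olat A B (z + z').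
Proof.
by move=> [a [b ->]] [a' [b' ->]]; exists (a + a'), (b + b'); congr pair => /=; ring.
Qed.

Lemma olat0 A B : olat A B 0.
Proof. by exists 0, 0; congr pair; ring. Qed.

(** Stability under omega: omega A = A (B + omega) - B A and omega (B + omega) = (B + sigma) (B +
    omega) - C A. *)
Lemma olat_ideal A B C z z' : N B 1 = C * A -> olat A B z -> olat A B (z' * z).
Proof.
move=> NE [a [b ->]].
exists (z'.1 * a - z'.2 * a * B - b * C * z'.2),
  (z'.1 * b + z'.2 * a * A + z'.2 * b * B + s * z'.2 * b).
have /eqP : N B 1 - C * A = 0 by rewrite NE subrr.
rewrite /Q0 !intz => /eqP E; congr pair => /=; last by ring.
apply/eqP; rewrite -subr_eq0; apply/eqP.
transitivity (- (b * z'.2) * (B ^+ 2 + s * B * 1 - m * 1 ^+ 2 - C * A)); first by ring.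
by rewrite E mulr0.
Qed.

(* The square of a common divisor divides D, with quotient again of the shape
   y^2 - 4 x z; so this is where D has to be fundamental. *)
Lemma primitive_form A B C : N B 1 = C * A ->
  exists x y z : int, x * A + y * (2 * B + s) + z * C = 1.
Proof.
move=> NE; set g := gcdz A (2 * B + s); set h := gcdz g C.
have hu : h \is a GRing.unit.
  have /dvdzP[A' AE] : (h %| A)%Z by apply: dvdz_trans (dvdz_gcdl _ _) (dvdz_gcdl _ _).
  have /dvdzP[B' BE] : (h %| 2 * B + s)%Z.
    by apply: dvdz_trans (dvdz_gcdl _ _) (dvdz_gcdr _ _).
  have /dvdzP[C' CE] : (h %| C)%Z by apply: dvdz_gcdr.
  apply: (@fundamental_unit D h B' (A' * C')).
  transitivity ((2 * B + s) ^+ 2 - 4 * N B 1); last by rewrite NE BE {1}AE {1}CE; ring.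
  by rewrite Q0_mul4; ring.
have h1 : h = 1.
  have : 0 <= h by [].
  by move: hu; rewrite qualifE /= => /orP[]/eqP->.
have [x [y Exy]] := Bezoutz A (2 * B + s); have [u [v Euv]] := Bezoutz g C.
by exists (u * x), (u * y), v; apply: etrans h1; rewrite /h -Euv /g -Exy; ring.
Qed.

(** Dirichlet composition of a form with itself. As (B + omega)^2 = e v (B + omega) - A C, the
    combination v A (B + omega) - u (B + omega)^2 equals e u^2 C, which with A^2 = e^2 u^2 yields e
    u^2; and j A (B + omega) + l (B + omega)^2 is e (B - l u C + omega). *)
Lemma olat_sqr A B C e u v j l x y : N B 1 = C * A ->
  A = e * u -> 2 * B + s = e * v -> j * u + l * v = 1 -> x * e + y * C = 1 ->
  ideal_mul (olat A B) (olat A B) = dilate (qint e) (olat (u ^+ 2) (B - l * u * C)).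
Proof.
move=> NE AE BE ju xe.
have BB : B ^+ 2 + m = e * v * B - C * A by rewrite -BE -NE /Q0 !intz; ring.
apply/seteqP; split.
  apply: ideal_mul_sub.
  - by exists 0; [exact: olat0 | rewrite mulr0].
  - move=> _ _ [z Iz ->] [z' Iz' ->]; exists (z + z'); last by rewrite mulrDr.
    exact: olatD.
  move=> _ _ [a [c ->]] [a' [c' ->]].
  (* After division by e, the product has coordinates t, w on the basis u^2, B - l u C + omega. *)
  pose w := a * c' * u + c * a' * u + c * c' * v.
  pose t := a * a' * e + (a * c' + c * a') * (l * C) - c * c' * C * j.
  exists (t * u ^+ 2 + w * (B - l * u * C), w); first by exists t, w.
  congr pair => /=; last first.
    transitivity ((a * c' + c * a') * A + c * c' * (2 * B + s)); first by ring.
    by rewrite AE BE /w; ring.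
  transitivity (a * a' * A ^+ 2 + (a * c' + c * a') * A * B + c * c' * (B ^+ 2 + m)).
    by ring.
  rewrite BB AE; apply: (@eq_lincomb _ _ (c * c' * e * u * C) _ _ ju).
  by rewrite /w /t; ring.
set P := ideal_mul _ _.
have PZ (k : int) z : P z -> P (qint k * z).
  by apply: ideal_mulZ => z'; apply: olat_ideal NE.
have PD z t : P z -> P t -> P (z + t) by apply: ideal_mulD.
have G a b a' b' : P (((a * A + b * B, b) : quad D) * ((a' * A + b' * B, b') : quad D)).
  by apply: mem_ideal_mul; [exists a, b | exists a', b'].
have H1 : P (e * u ^+ 2, 0).
  have := PD _ _ (PZ x _ (G 1 0 1 0))
    (PZ y _ (PD _ _ (PZ v _ (G 1 0 0 1)) (PZ (- u) _ (G 0 1 0 1)))).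
  congr P; congr pair => /=; last first.
    transitivity (y * (v * A - u * (2 * B + s))); first by ring.
    by rewrite AE BE; ring.
  transitivity (x * A ^+ 2 + y * (v * A * B - u * (B ^+ 2 + m))); first by ring.
  rewrite BB AE; apply: (@eq_lincomb _ _ (e * u ^+ 2) _ _ xe); ring.
have H2 : P (e * (B - l * u * C), e).
  have := PD _ _ (PZ j _ (G 1 0 0 1)) (PZ l _ (G 0 1 0 1)).
  congr P; congr pair => /=; last first.
    transitivity (j * A + l * (2 * B + s)); first by ring.
    rewrite AE BE; apply: (@eq_lincomb _ _ e _ _ ju); ring.
  transitivity (j * A * B + l * (B ^+ 2 + m)); first by ring.
  rewrite BB AE; apply: (@eq_lincomb _ _ (e * B) _ _ ju); ring.
move=> _ [_ [a [b ->]] ->].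
have := PD _ _ (PZ a _ H1) (PZ b _ H2); congr P; congr pair => /=; ring.
Qed.

Lemma olat_class A B B' k : B - B' = k * A -> olat A B = olat A B'.
Proof.
have H E E' h : E - E' = h * A -> olat A E `<=` olat A E'.
  move=> EE _ [a [b ->]]; exists (a + b * h), b; congr pair.
  by rewrite mulrDl -mulrA -EE; ring.
move=> BE; apply/seteqP; split; [exact: H BE | apply: (H _ _ (- k))].
by rewrite mulNr -BE opprB.
Qed.

(** Here C = q A is a multiple of A, so primitivity makes A prime to 2 B + sigma. Composition then
    applies with e = 1, and it moves the shift by a multiple of A^2 only. *)
Lemma form_ideal_sqr d :
  ideal_mul (olat (lead d) (shift d)) (olat (lead d) (shift d)) = lat 1 d.
Proof.
have [q NE] := leadN d.
have NE' : N (shift d) 1 = (q * lead d) * lead d by rewrite NE; ring.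
have [x [y [z E]]] := primitive_form NE'.
rewrite (@olat_sqr _ _ _ 1 (lead d) (2 * shift d + s) (x + z * q) y 1 0 NE') ?mul1r ?mulr1 //.
- rewrite lat1E -[qint 1]/(1 : quad D) dilate1; apply: (@olat_class _ _ _ (- (y * q))); ring.
- by rewrite -[RHS]E; ring.
- by rewrite mul0r addr0.
Qed.

Lemma olat_sqr_form A B C : 0 < A -> N B 1 = C * A ->
  exists d e, 0 < e /\ ideal_mul (olat A B) (olat A B) = lat e d.
Proof.
move=> A0 NE; have [x [y [z E]]] := primitive_form NE.
set e := gcdz A (2 * B + s).
have e0 : 0 < e.
  by rewrite lt_def andbT gcdz_eq0 negb_and (gt_eqF A0).
have /dvdzP[u uE] : (e %| A)%Z by apply: dvdz_gcdl.
have /dvdzP[v vE] : (e %| 2 * B + s)%Z by apply: dvdz_gcdr.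
have [j [l ju]] := Bezoutz A (2 * B + s); rewrite -/e in ju.
have ju' : j * u + l * v = 1.
  by apply: (mulIf (lt0r_neq0 e0)); rewrite mul1r -[RHS]ju uE vE; ring.
have xe : (x * u + y * v) * e + z * C = 1 by rewrite -[RHS]E uE vE; ring.
have u0 : 0 < u by rewrite -(pmulr_lgt0 _ e0) -uE.
have uE' : A = e * u by rewrite uE mulrC.
have vE' : 2 * B + s = e * v by rewrite vE mulrC.
have fc : form_cond D (u, B - l * u * C).
  (* N(B - l u C) = e u C (1 - l v) + l^2 u^2 C^2, and 1 - l v = j u. *)
  rewrite /form_cond u0 /=; apply/dvdzP; exists (e * j * C + l ^+ 2 * C ^+ 2).
  transitivity (N B 1 - l * u * C * (2 * B + s) + l ^+ 2 * u ^+ 2 * C ^+ 2).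
    by rewrite /Q0 !intz; ring.
  rewrite NE vE' uE'; apply: (@eq_lincomb _ _ (- e * u * C) _ _ ju'); ring.
by exists (FormData fc), e; split; rewrite // (olat_sqr NE uE' vE' ju' xe) latE.
Qed.

(** The divisibility puts z in the lattice, which is an ideal. Conversely A^2 = z conj z and b +
    omega are multiples of z. *)
Lemma lat1_principal d z : N z.1 z.2 = lead d ^+ 2 ->
  (lead d ^+ 2 %| z.1 - z.2 * shift d)%Z -> lat 1 d = dilate z setT.
Proof.
move=> Nz /dvdzP[t tE]; have [q qE] := leadN d; rewrite lat1E.
apply/seteqP; split=> [_ [a [b ->]]|_ [y _ ->]]; last first.
  rewrite mulrC; apply: (olat_ideal _ qE); exists t, z.2; rewrite -tE.
  by case: z {Nz tE} => x w; congr pair => /=; ring.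
(* The factor of b is (shift d + omega) conj z / A^2, the quotient of shift d + omega by z. *)
exists (qint a * qconj z + qint b * (t * shift d + z.2 * q, t)) => //.
have n0 : lead d ^+ 2 != 0 by rewrite expf_neq0 // lt0r_neq0 ?lead_gt0.
have E1 : z.1 * (t * shift d + z.2 * q) + m * z.2 * t = shift d.
  apply: (mulfI n0); transitivity (z.1 * ((t * lead d ^+ 2) * shift d
    + z.2 * (q * lead d ^+ 2)) + m * z.2 * (t * lead d ^+ 2)); first by ring.
  by rewrite -tE -qE -Nz /Q0 !intz; ring.
have E2 : z.1 * t + z.2 * (t * shift d + z.2 * q) + s * z.2 * t = 1.
  apply: (mulfI n0); transitivity (z.1 * (t * lead d ^+ 2)
    + z.2 * ((t * lead d ^+ 2) * shift d + z.2 * (q * lead d ^+ 2))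
    + s * z.2 * (t * lead d ^+ 2)); first by ring.
  by rewrite -tE -qE -Nz /Q0 !intz; ring.
rewrite mulrDr [z * (qint a * _)]mulrCA mul_qconj -qintM Nz [z * (qint b * _)]mulrCA.
congr pair => /=; first by rewrite E1; ring.
by rewrite E2; ring.
Qed.

(** The conjugate of b + omega is the opposite of - b - sigma + omega. *)
Lemma conj_lat1 d : qconj @` lat 1 d = lat 1 (data_inv d).
Proof.
rewrite !lat1E; apply/seteqP; split=> [_ [_ [a [b ->]] <-]|_ [a [b ->]]].
  exists a, (- b); rewrite /shift /lead /=.
  by congr pair => /=; rewrite -/(shift d) -/(lead d); ring.
exists (a * lead d ^+ 2 + (- b) * shift d, - b); first by exists a, (- b).
by rewrite /shift /lead /=; congr pair => /=; rewrite -/(shift d) -/(lead d); ring.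
Qed.

Lemma qconjK : involutive qconj.
Proof. by case=> a b; congr pair => /=; ring. Qed.

(** An ideal times its conjugate is generated by its norm: [shift_plus] vanishes, so [esq] is all of
    A^2 and the remaining class is trivial. *)
Lemma lat_mul_inv d :
  ideal_mul (lat 1 (data_inv d)) (lat 1 d) = dilate (qint (lead d ^+ 2)) setT.
Proof.
have e : esq (data_inv d) d = lead d ^+ 2.
  rewrite /esq; have -> : shift_plus (data_inv d) d = 0.
    by rewrite /shift_plus {1}/shift /=; ring.
  by rewrite {1}/lead /= -/(lead d) gcdz0 gcdzz !gez0_abs ?sqr_ge0.
rewrite lat_mul !mul1r e (lat_class _ (data_mulV d)) latE; congr dilate.
by apply/seteqP; split=> // -[a b] _; exists a, b; congr pair; rewrite /shift /lead /=; ring.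
Qed.

(* The class of [data_inv d] is conjugate to that of [d], so their product
   compares the norm of a generator with the index of the lattice. *)
Lemma principal_norm d z : lat 1 d = dilate z setT ->
  0 < N z.1 z.2 -> N z.1 z.2 = lead d ^+ 2.
Proof.
move=> E N0; have n0 : 0 < lead d ^+ 2 by rewrite exprn_gt0 ?lead_gt0.
have E' : lat 1 (data_inv d) = dilate (qconj z) setT.
  rewrite -conj_lat1 E; apply/seteqP; split=> [_ [_ [y _ ->] <-]|_ [y _ ->]].
    by exists (qconj y); rewrite ?qconjM.
  by exists (z * qconj y); [exists (qconj y) | rewrite qconjM qconjK].
have := lat_mul_inv d; rewrite E E' dilate_mul ideal_mul_setT mulrC mul_qconj => F.
have dvd k l : dilate (qint k) setT = dilate (qint l) setT -> (l %| k)%Z.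
  move=> /seteqP[/(_ (qint k)) + _]; case; first by exists 1; rewrite ?mulr1.
  move=> [a b] _ /(congr1 fst) /= ->; apply/dvdzP; exists a; ring.
by apply: gtz_dvd_eq => //; [apply: dvd (esym F) | apply: dvd F].
Qed.

(** Serves to compare classes of rational points after clearing denominators. *)
Lemma same_class_lat c c' d d' : 0 < c -> 0 < c' ->
  dilate (qint c) (lat 1 d) = dilate (qint c') (lat 1 d') -> same_class d d'.
Proof.
by move=> c0 c'0; rewrite -!lat_dilate !mulr1; apply: lat_inj.
Qed.
End QuadOrder.

(** * Embeddings and the ring of integers *)

Section IntegralCoordinates.
Variable D : fund_disc.
Local Notation s := (sigma D).
Local Notation m := (mpar D).
Local Notation N := (Q0 D).

Lemma parityz (x : int) : exists t, x = 2 * t \/ x = 2 * t + 1.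
Proof.
exists (x %/ 2)%Z; have := divz_eq x 2; have := modz_ge0 x (d := 2) isT.
have := ltz_pmod x (d := 2) isT; lia.
Qed.

(** If (a + b omega) / n has integral trace T and norm M, it lies in Z[omega]. With b / n = b' / n'
    in lowest terms, D b'^2 = n'^2 (T^2 - 4 M), so D = r n'^2; as r is 0 or 1 modulo 4 and D is
    fundamental, n' is a unit. *)
Lemma integral_coords (a b n T M : int) : n != 0 ->
  2 * a + s * b = n * T -> N a b = n ^+ 2 * M ->
  exists a' b' : int, a = n * a' /\ b = n * b'.
Proof.
move=> n0 trE nE; set g := gcdz b n.
have g0 : g != 0 by rewrite gcdz_eq0 negb_and n0 orbT.
have /dvdzP[b' bE] : (g %| b)%Z by apply: dvdz_gcdl.
have /dvdzP[n' n'E] : (g %| n)%Z by apply: dvdz_gcdr.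
have [j [l jl]] := Bezoutz b n; rewrite -/g in jl.
have jl' : j * b' + l * n' = 1.
  by apply: (mulIf g0); rewrite mul1r -[RHS]jl {1}bE {1}n'E; ring.
have E : (D : int) * b' ^+ 2 = n' ^+ 2 * (T ^+ 2 - 4 * M).
  apply: (mulIf (expf_neq0 2 g0)).
  transitivity ((2 * a + s * b) ^+ 2 - 4 * N a b).
    by rewrite Q0_mul4 bE; ring.
  by rewrite trE nE n'E; ring.
have cop : coprimez (n' ^+ 2) (b' ^+ 2).
  rewrite coprimezXl // coprimezXr //; apply/coprimezP; exists (l, j) => /=.
  by rewrite addrC.
have /dvdzP[r rE] : (n' ^+ 2 %| (D : int))%Z.
  by rewrite -(Gauss_dvdzl _ cop) E dvdz_mulr.
have n'0 : n' != 0 by apply: contraNneq n0 => z; rewrite n'E z mul0r.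
have E' : r * b' ^+ 2 = T ^+ 2 - 4 * M.
  by apply: (mulfI (expf_neq0 2 n'0)); rewrite -E rE; ring.
have n'u : n' \is a GRing.unit.
  (* r must be written x^2 - 4 y. If b' is even then n' is odd and r is congruent to D modulo 4; if
     b' is odd, r is congruent to T^2. *)
  have [k [kE | kE]] := parityz b'.
    have [i [iE | iE]] := parityz n'.
      by move: jl'; rewrite kE iE; lia.
    apply: (@fundamental_unit D n' s (r * (i ^+ 2 + i) - m)).
    rewrite {1}rE sigma_sqr mulrC; congr (_ * _).
    have : s + 4 * m = r * (2 * i + 1) ^+ 2 by rewrite -disc_eq rE iE.
    by move=> F; apply: (@eq_lincomb _ _ (- 1) _ _ F); ring.
  apply: (@fundamental_unit D n' T (M + r * (k ^+ 2 + k))).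
  rewrite {1}rE mulrC; congr (_ * _).
  by move: E'; rewrite kE => F; apply: (@eq_lincomb _ _ 1 _ _ F); ring.
have n'2 : n' ^+ 2 = 1 by move: n'u; rewrite qualifE /= => /orP[]/eqP->.
pose c := b' * n'.
have bc : b = n * c.
  by rewrite /c n'E bE -[LHS]mulr1 -[X in _ * X = _]n'2; ring.
have Tc : 2 * a = n * (T - s * c).
  by apply: (@eq_lincomb _ _ 1 _ _ trE); rewrite bc; ring.
(* The odd case is impossible, since T^2 is congruent to (s c)^2 modulo 4. *)
have [i [iE | iE]] := parityz (T - s * c).
  exists i, c; split=> //; apply: (@mulfI _ (2 : int)) => //.
  by rewrite Tc iE; ring.
have Ec : T ^+ 2 = (s + 4 * m) * c ^+ 2 + 4 * M.
  rewrite -disc_eq /c exprMn mulrA E n'2; ring.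
have TE : T = s * c + (2 * i + 1) by rewrite -iE; ring.
have : (s * c) ^+ 2 = s * c ^+ 2 by rewrite exprMn sigma_sqr.
move: Ec; rewrite TE => Ec F.
have : 2 * (2 * (i ^+ 2 + i) + s * c * (2 * i + 1) - 2 * m * c ^+ 2 - 2 * M) + 1
    = s * c ^+ 2 - (s * c) ^+ 2.
  by apply: (@eq_lincomb _ _ 1 _ _ Ec); ring.
rewrite F subrr; move: (_ - _) => x; clear; lia.
Qed.
End IntegralCoordinates.

(** * Ring maps from Z[omega] to a field *)

Section QuadMap.
Variables (D : fund_disc) (L : fieldType) (w : L).
Hypothesis wE : w ^+ 2 = (mpar D)%:~R + (sigma D)%:~R * w.
Local Notation N := (Q0 D).

Definition qmap (z : quad D) : L := z.1%:~R + z.2%:~R * w.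

Lemma qmapD z z' : qmap (z + z') = qmap z + qmap z'.
Proof.
case: z z' => [a b] [a' b']; rewrite -[qmap (_ + _)]/((a + a')%:~R + (b + b')%:~R * w) /qmap /=.
by rewrite !intrD mulrDl addrACA.
Qed.

Lemma qmapM z z' : qmap (z * z') = qmap z * qmap z'.
Proof.
have key (a b a' b' M S : L) : w ^+ 2 = M + S * w ->
    a * a' + M * b * b' + (a * b' + b * a' + S * b * b') * w =
    (a + b * w) * (a' + b' * w).
  move=> E; transitivity (a * a' + (a * b' + b * a') * w + b * b' * w ^+ 2); last by ring.
  by rewrite E; ring.
rewrite /qmap /=; move: (sigma D) (mpar D) wE => S0 M E; rewrite !(intrD, intrM); apply: key E.
Qed.

Lemma qmap_int (k : int) : qmap (qint D k) = k%:~R.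
Proof. by rewrite /qmap /= mul0r addr0. Qed.

Lemma qmap0 : qmap 0 = 0. Proof. exact: (qmap_int 0). Qed.
Lemma qmap1 : qmap 1 = 1. Proof. exact: (qmap_int 1). Qed.
Lemma qmapN z : qmap (- z) = - qmap z.
Proof. by apply/eqP; rewrite -addr_eq0 -qmapD addNr qmap0. Qed.

Hypothesis char0 : forall k : int, (k%:~R == 0 :> L) = (k == 0).

(** A kernel element has norm z conj z = 0, and the norm form is anisotropic. *)
Lemma qmap_eq0 z : qmap z = 0 -> z = 0.
Proof.
move=> z0; have : (N z.1 z.2)%:~R == 0 :> L.
  by rewrite -qmap_int -mul_qconj qmapM z0 mul0r.
by rewrite char0 => /eqP/Q0_eq0[]; case: (z) => a b /= -> ->.
Qed.

Lemma qmap_inj : injective qmap.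
Proof.
move=> z z' E; apply/eqP; rewrite -subr_eq0; apply/eqP/qmap_eq0.
by rewrite qmapD qmapN E subrr.
Qed.

Lemma qmap_ideal_mul I J :
  ideal_mul (qmap @` I) (qmap @` J) = qmap @` ideal_mul I J.
Proof.
apply/seteqP; split.
  apply: ideal_mul_sub.
  - by exists 0; [exact: ideal_mul0 | exact: qmap0].
  - move=> _ _ [x Ix <-] [y Iy <-]; exists (x + y); last by rewrite qmapD.
    exact: ideal_mulD.
  - move=> _ _ [x Ix <-] [y Jy <-]; exists (x * y); last by rewrite qmapM.
    exact: mem_ideal_mul.
move=> _ [t + <-]; move: t.
apply: (@ideal_mul_sub _ _ _ (fun t => ideal_mul _ _ (qmap t))).
- by rewrite qmap0; apply: ideal_mul0.
- by move=> *; rewrite qmapD; apply: ideal_mulD.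
- by move=> x y Ix Jy; rewrite qmapM; apply: mem_ideal_mul; [exists x | exists y].
Qed.
End QuadMap.

(** * K as the fraction field of Z[omega], and its embeddings *)

Section QuadField.
Variables (D : fund_disc) (K : fieldExtType rat) (sqrtD : K).
Hypothesis sqrtD2 : sqrtD ^+ 2 = (disc D)%:~R.
Local Notation s := (sigma D).
Local Notation m := (mpar D).
Local Notation N := (Q0 D).
Local Notation om := (omega D sqrtD).
Local Notation phi := (@qmap D K om).

Lemma intr_field_eq0 (k : int) : (k%:~R == 0 :> K) = (k == 0).
Proof. by rewrite -(rmorph_int (in_alg K)) fmorph_eq0 intr_eq0. Qed.

Lemma half_root (L : fieldType) (r : L) : (2 : L) != 0 -> r ^+ 2 = (disc D)%:~R ->
  ((s%:~R + r) / 2) ^+ 2 = m%:~R + s%:~R * ((s%:~R + r) / 2).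
Proof.
move=> n2 rE; set w := _ / 2.
have n4 : (4 : L) != 0 by rewrite -[4]/((2 * 2)%:R) natrM mulf_neq0.
have wE : 2 * w = s%:~R + r by rewrite mulrC divfK.
apply: (mulfI n4); have -> : 4 * w ^+ 2 = (2 * w) ^+ 2 by ring.
have DE : (disc D)%:~R = s%:~R ^+ 2 + 4 * m%:~R :> L.
  by rewrite {1}disc_eq -{1}sigma_sqr rmorphD rmorphXn rmorphM.
transitivity (s%:~R ^+ 2 + 2 * (s%:~R * r) + r ^+ 2); first by rewrite wE; ring.
rewrite rE DE.
transitivity (4 * m%:~R + 2 * s%:~R * (2 * w)); last by ring.
by rewrite wE; ring.
Qed.

Lemma omega_sqr : om ^+ 2 = m%:~R + s%:~R * om.
Proof. by apply: half_root sqrtD2; rewrite (intr_field_eq0 2). Qed.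

Lemma phi_inj : injective phi.
Proof. exact: qmap_inj omega_sqr intr_field_eq0. Qed.

Let phiM := qmapM omega_sqr.

Hypothesis K_gen : <<1; sqrtD>>%VS = fullv.

Lemma quad_coord (x : K) : exists z n, n != 0 /\ n%:~R * x = phi z.
Proof.
have : x \in <<1; sqrtD>>%VS by rewrite K_gen memvf.
move=> /Fadjoin_polyP[p /polyOver1P[q ->] ->] {p x}.
elim/poly_ind: q => [|q c [z [n [n0 E]]]].
  by exists 0, 1; rewrite rmorph0 horner0 mulr0 qmap0.
(* Horner step: the pair (- s, 2) is 2 omega - sigma = sqrtD, and the common denominator picks up
   that of c. *)
exists (qint D (denq c) * z * ((- s, 2) : quad D) + qint D (n * numq c)), (denq c * n).
split; first by rewrite mulf_neq0 ?denq_neq0.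
rewrite qmapD !phiM !qmap_int -E rmorphD rmorphM /= map_polyX map_polyC /= hornerMXaddC.
have -> : phi (- s, 2) = sqrtD.
  rewrite /qmap /= /omega mulrC divfK ?(intr_field_eq0 2) //.
  by rewrite rmorphN /= addrA addNr add0r.
have -> : (n * numq c)%:~R = n%:~R * ((denq c)%:~R * c%:A) :> K.
  rewrite intrM; congr (_ * _); rewrite -!(rmorph_int (in_alg K)) /= -scalerAl mul1r scalerA.
  by rewrite [_ * c]mulrC numqE.
by rewrite intrM; ring.
Qed.

Section Extension.
Variables (L : numFieldType) (w : L).
Hypothesis wE : w ^+ 2 = m%:~R + s%:~R * w.

(** The value must be [qmap w z] / n; injectivity of phi makes it independent of the presentation n
    x = phi z. *)
Lemma ext_exists x : exists y : L,
  forall z n, n != 0 -> n%:~R * x = phi z -> n%:~R * y = qmap w z.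
Proof.
have [z' [n' [n'0 E']]] := quad_coord x.
have n'L : n'%:~R != 0 :> L by rewrite intr_eq0.
exists (qmap w z' / n'%:~R) => z n n0 E; apply: (mulfI n'L).
have -> : n'%:~R * (n%:~R * (qmap w z' / n'%:~R)) = n%:~R * qmap w z'.
  by rewrite mulrCA [n'%:~R * _]mulrC divfK.
rewrite -!(qmap_int D w) -!(qmapM wE); congr qmap.
by apply: phi_inj; rewrite !phiM !qmap_int -E -E' mulrCA.
Qed.

Definition ext x : L := projT1 (cid (ext_exists x)).

Lemma extE x z n : n != 0 -> n%:~R * x = phi z -> n%:~R * ext x = qmap w z.
Proof. by rewrite /ext; case: cid => /= y; apply. Qed.

Lemma ext_unique x y z n : n != 0 -> n%:~R * x = phi z -> n%:~R * y = qmap w z ->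
  ext x = y.
Proof.
move=> n0 E F; have nL : n%:~R != 0 :> L by rewrite intr_eq0.
by apply: (mulfI nL); rewrite (extE n0 E) F.
Qed.

Lemma ext_phi z : ext (phi z) = qmap w z.
Proof. by apply: (@ext_unique _ _ z 1); rewrite ?mul1r. Qed.

Fact ext_zmod_morphism : zmod_morphism ext.
Proof.
move=> x y; have [z [n [n0 E]]] := quad_coord x.
have [z' [n' [n'0 E']]] := quad_coord y.
apply: (@ext_unique _ _ (qint D n' * z - qint D n * z') (n * n')).
- by rewrite mulf_neq0.
- by rewrite qmapD qmapN !phiM !qmap_int -E -E' intrM; ring.
- rewrite qmapD qmapN !(qmapM wE) !qmap_int -(extE n0 E) -(extE n'0 E') intrM; ring.
Qed.

Fact ext_monoid_morphism : monoid_morphism ext.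
Proof.
split=> [|x y].
  by apply: (@ext_unique _ _ 1 1); rewrite ?mul1r ?qmap1.
have [z [n [n0 E]]] := quad_coord x; have [z' [n' [n'0 E']]] := quad_coord y.
apply: (@ext_unique _ _ (z * z') (n * n')).
- by rewrite mulf_neq0.
- by rewrite phiM -E -E' intrM; ring.
- by rewrite (qmapM wE) -(extE n0 E) -(extE n'0 E') intrM; ring.
Qed.

HB.instance Definition _ := GRing.isZmodMorphism.Build K L ext ext_zmod_morphism.
HB.instance Definition _ := GRing.isMonoidMorphism.Build K L ext ext_monoid_morphism.

Definition ext_rmorphism : {rmorphism K -> L} := ext.
End Extension.
End QuadField.

(** * The ring of integers, and norms against total positivity *)

Section RingOfIntegers.
Variables (D : fund_disc) (K : fieldExtType rat) (sqrtD : K).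
Hypothesis sqrtD2 : sqrtD ^+ 2 = (disc D)%:~R.
Hypothesis K_gen : <<1; sqrtD>>%VS = fullv.
Local Notation s := (sigma D).
Local Notation m := (mpar D).
Local Notation N := (Q0 D).
Local Notation om := (omega D sqrtD).
Local Notation phi := (@qmap D K om).

Lemma conj_root_sum (L : fieldType) (w w' : L) :
  w ^+ 2 = m%:~R + s%:~R * w -> w' ^+ 2 = m%:~R + s%:~R * w' ->
  w = w' \/ w + w' = s%:~R.
Proof.
move=> E E'; have : (w - w') * (w + w' - s%:~R) = 0.
  transitivity (w ^+ 2 - w' ^+ 2 - s%:~R * (w - w')); first by ring.
  by rewrite E E'; ring.
move=> /eqP; rewrite mulf_eq0 !subr_eq0 => /orP[]/eqP; by [left | right].
Qed.

Lemma qmap_norm (L : fieldType) (w w' : L) (z : quad D) :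
  w ^+ 2 = m%:~R + s%:~R * w -> w + w' = s%:~R ->
  qmap w z * qmap w' z = (N z.1 z.2)%:~R.
Proof.
move=> wE ww; rewrite -(qmap_int D w) -mul_qconj (qmapM wE); congr (_ * _).
rewrite /qmap /=; have -> : w' = s%:~R - w by rewrite -ww addrC addKr.
by move: s => S0; rewrite intrD intrM rmorphN /=; ring.
Qed.

(** [f0] and [f1] below are the two conjugate embeddings of K, sending omega to [w0] and [w1]. *)
Let r : algC := sqrtC (disc D)%:~R.
Let w0 : algC := (s%:~R + r) / 2.
Let w1 : algC := (s%:~R + - r) / 2.
Let two_neq0 : (2 : algC) != 0. Proof. by rewrite pnatr_eq0. Qed.
Let w0E : w0 ^+ 2 = m%:~R + s%:~R * w0.
Proof. by apply: half_root; rewrite ?two_neq0 ?sqrtCK. Qed.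
Let w1E : w1 ^+ 2 = m%:~R + s%:~R * w1.
Proof. by apply: half_root; rewrite ?two_neq0 ?sqrrN ?sqrtCK. Qed.
Let w01 : w0 + w1 = s%:~R.
Proof.
by apply: (mulIf two_neq0); rewrite mulrDl !divfK //; ring.
Qed.
Let f0 := ext_rmorphism sqrtD2 K_gen w0E.
Let f1 := ext_rmorphism sqrtD2 K_gen w1E.

Lemma rmorph_integers_Aint (f : {rmorphism K -> algC}) x :
  integers x -> f x \in Aint.
Proof.
case=> p pm px; apply: (@root_monic_Aint (map_poly intr p)).
- have -> : map_poly intr p = map_poly f (map_poly intr p) :> {poly algC}.
    by rewrite -map_poly_comp; apply: eq_map_poly => k /=; rewrite rmorph_int.
  by rewrite fmorph_root.
- by rewrite monic_map.
- by apply/polyOverP => i; rewrite coef_map /= intr_int.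
Qed.

Lemma integers_intr (k : int) : integers (k%:~R : K).
Proof. exact: integral_id. Qed.

Lemma integers_omega : integers om.
Proof.
move: om (omega_sqr sqrtD2) => o oE; exists (('X - s%:P) * 'X - m%:P).
  rewrite monicE lead_coefDl ?lead_coefMX ?lead_coefXsubC //.
  rewrite size_polyN size_mulX ?polyXsubC_eq0 // size_XsubC.
  exact: leq_ltn_trans (size_polyC_leq1 _) _.
rewrite rootE rmorphB rmorphM rmorphB /= map_polyX !map_polyC /= !hornerE.
by rewrite mulrBl -expr2 oE addrK subrr.
Qed.

(** For x integral with n x = phi z, the sum and product of the two conjugates of x are rational
    algebraic integers, hence integers, and [integral_coords] divides z by n. *)
Lemma integers_phi : integers (K := K) = range phi.
Proof.
apply/seteqP; split=> [x Ix|_ [[a b] _ <-]]; last first.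
  apply: integersD; first exact: integers_intr.
  by apply: integersM; [exact: integers_intr | exact: integers_omega].
have [z [n [n0 E]]] := quad_coord sqrtD2 K_gen x.
have nC : n%:~R != 0 :> algC by rewrite intr_eq0.
have E0 : n%:~R * f0 x = qmap w0 z := extE sqrtD2 K_gen w0E n0 E.
have E1 : n%:~R * f1 x = qmap w1 z := extE sqrtD2 K_gen w1E n0 E.
have I0 := rmorph_integers_Aint f0 Ix; have I1 := rmorph_integers_Aint f1 Ix.
have F0 : n%:~R * (f0 x + f1 x) = (2 * z.1 + s * z.2)%:~R.
  rewrite mulrDr E0 E1; transitivity (2 * z.1%:~R + z.2%:~R * (w0 + w1)).
    by rewrite /qmap; ring.
  by rewrite w01; move: s => S0; rewrite intrD !intrM [S0%:~R * _]mulrC.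
have F1 : n%:~R ^+ 2 * (f0 x * f1 x) = (N z.1 z.2)%:~R.
  by rewrite -(qmap_norm _ w0E w01) -E0 -E1; ring.
have ratP (k l : int) (y : algC) : l != 0 -> l%:~R * y = k%:~R -> y \in Crat.
  move=> l0 yE; have -> : y = k%:~R / l%:~R.
    by rewrite -yE mulrC mulKf // intr_eq0.
  by rewrite rpred_div // rpred_int.
have /intrP[T TE] : f0 x + f1 x \is a Num.int.
  by apply: Cint_rat_Aint; [apply: ratP F0 | apply: rpredD].
have /intrP[M ME] : f0 x * f1 x \is a Num.int.
  apply: Cint_rat_Aint; last by apply: rpredM.
  by apply: (ratP _ (n ^+ 2) _ _ _); rewrite ?expf_neq0 // rmorphXn; exact: F1.
have [|| a' [b' [aE bE]]] := @integral_coords D z.1 z.2 n T M n0.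
- by apply: (@intr_inj algC); rewrite intrM -TE F0.
- by apply: (@intr_inj algC); rewrite intrM rmorphXn /= -ME F1.
exists (a', b') => //; apply: (@mulfI _ (n%:~R : K)); first by rewrite intr_field_eq0.
rewrite E -(qmap_int D om) -(qmapM (omega_sqr sqrtD2)); congr qmap.
by case: z {E E0 E1 F0 F1} aE bE => a b /= -> ->; congr pair => /=; ring.
Qed.

Let ext_real (w : algC) (wE : w ^+ 2 = m%:~R + s%:~R * w) : w \is Num.real ->
  forall x, ext_rmorphism sqrtD2 K_gen wE x \is Num.real.
Proof.
move=> wR x; have [z [n [n0 E]]] := quad_coord sqrtD2 K_gen x.
have -> : ext_rmorphism sqrtD2 K_gen wE x = qmap w z / n%:~R.
  by apply: (ext_unique sqrtD2 K_gen wE n0 E); rewrite mulrC divfK ?intr_eq0.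
by rewrite realM ?realV ?realn ?realz // realD ?realM ?realz.
Qed.

(** For D >= 0 the norm is the product of the values under two real embeddings; for D < 0 the norm
    form is positive definite. *)
Lemma norm_gt0_of_totally (z : quad D) : totally_positive (phi z) -> 0 < N z.1 z.2.
Proof.
move=> [z0 zp]; have [D0 | D0] := leP 0 (disc D).
  have rR : r \is Num.real by rewrite ger0_real // sqrtC_ge0 ler0z.
  have half x : x \is Num.real -> (s%:~R + x) / 2 \is @Num.real algC.
    by move=> xR; rewrite realM ?realV ?realn // realD ?realz.
  have := mulr_gt0 (zp f0 (ext_real w0E (half _ rR)))
    (zp f1 (ext_real w1E (half _ (etrans (realN r) rR)))).
  rewrite /f0 /f1 /ext_rmorphism /= !ext_phi (qmap_norm _ w0E w01).
  by rewrite ltr0z.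
have n0 : N z.1 z.2 != 0.
  apply: contra_neq z0 => /Q0_eq0[a0 b0].
  by rewrite /qmap a0 b0 mul0r addr0.
rewrite lt_def n0 /= -(pmulr_rge0 _ (isT : 0 < (4 : int))) Q0_mul4.
by rewrite -mulNr addr_ge0 ?sqr_ge0 // mulr_ge0 ?sqr_ge0 // oppr_ge0 ltW.
Qed.

(** Without real embeddings there is nothing to check. Otherwise fix a real f: for any real g, the
    product f(z) g(z) is f(z)^2 or the norm, hence positive, so the sign of f(z) decides for all
    g. *)
Lemma totally_positive_up_to_sign (z : quad D) : 0 < N z.1 z.2 ->
  totally_positive (phi z) \/ totally_positive (phi (- z)).
Proof.
move=> N0; have z0 : phi z != 0.
  apply: contraTneq N0 => /(qmap_eq0 (omega_sqr sqrtD2) (@intr_field_eq0 K)) ->.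
  by rewrite /Q0 /= !(mulr0, expr0n, mul0r, subr0, addr0) ltxx.
have phiE (f : {rmorphism K -> algC}) : f (phi z) = @qmap D _ (f om) z.
  by rewrite /qmap rmorphD rmorphM !rmorph_int.
have rootE (f : {rmorphism K -> algC}) : (f om) ^+ 2 = m%:~R + s%:~R * f om.
  by rewrite -rmorphXn (omega_sqr sqrtD2) rmorphD rmorphM !rmorph_int.
have [[f fR]|no] := pselect (exists f : {rmorphism K -> algC},
    forall x, f x \is Num.real); last first.
  by left; split=> // f fR; case: no; exists f.
have prod (g : {rmorphism K -> algC}) : (forall x, g x \is Num.real) ->
    0 < f (phi z) * g (phi z).
  move=> gR; have [E|E] := conj_root_sum (rootE f) (rootE g).
    by rewrite [g _]phiE -E -phiE -expr2 real_exprn_even_gt0 ?fR // fmorph_eq0 z0.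
  by rewrite !phiE (qmap_norm _ (rootE f) E) ltr0z.
have fz0 : f (phi z) != 0 by rewrite fmorph_eq0.
case: (real_ltgtP (fR (phi z)) (real0 _)) fz0 => // [fn|fp] _.
  right; split; first by rewrite qmapN oppr_eq0.
  by move=> g /prod; rewrite qmapN rmorphN oppr_gt0 nmulr_rgt0.
by left; split=> // g /prod; rewrite pmulr_rgt0.
Qed.
End RingOfIntegers.

(** * Ideals and the map rho *)

Section IdealBases.
Variable D : fund_disc.
Local Notation s := (sigma D).
Local Notation m := (mpar D).
Local Notation N := (Q0 D).

Lemma int_subgroup_gen (P : int -> Prop) x : (forall y z, P y -> P z -> P (y - z)) ->
  P x -> x != 0 -> exists2 g, 0 < g & P g /\ forall y, P y -> exists q, y = q * g.
Proof.
move=> PB Px x0.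
have P0 : P 0 by rewrite -(subrr x); apply: PB.
have PN y : P y -> P (- y) by move=> Py; rewrite -sub0r; apply: PB.
have PM (q : int) y : P y -> P (q * y).
  move=> Py; suff nat_mul (n : nat) : P (n%:Z * y).
    by case: (intP q) => [|n|n]; rewrite ?mul0r // mulNr; exact/PN/nat_mul.
  elim: n => [|n IHn]; first by rewrite mul0r.
  by rewrite intS mulrDl mul1r -[_ * y]opprK; apply: PB => //; apply: PN.
pose Q (n : nat) := (0 < n)%N && `[< P n%:Z >].
have exQ : exists n, Q n.
  exists `|x|%N; rewrite /Q absz_gt0 x0; apply/asboolP.
  have [x_ge0|x_lt0] := leP 0 x; first by rewrite gez0_abs.
  by rewrite ltz0_abs //; apply: PN.
case: (ex_minnP exQ) => g /andP[g0 /asboolP Pg] gmin.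
exists g%:Z; rewrite ?ltz_nat //; split=> // y Py; exists (y %/ g)%Z.
have g0' : (g : int) != 0 by rewrite gt_eqF.
rewrite {1}(divz_eq y g); suff -> : (y %% g)%Z = 0 by rewrite addr0.
have r_ge0 := modz_ge0 y g0'; have := ltz_mod y g0'; rewrite ger0_norm // => r_lt.
have Pr : P (y %% g)%Z.
  by rewrite -[X in P X](addKr ((y %/ g)%Z * g)) -divz_eq addrC; apply: PB => //; apply: PM.
apply/eqP/negPn/negP => r0; have := gmin `|(y %% g)%Z|%N.
rewrite /Q absz_gt0 r0 gez0_abs //= => /(_ (asboolT Pr)).
by rewrite leqNgt -ltz_nat gez0_abs // r_lt.
Qed.

(** Let g generate the omega-coordinates of J, reached at h + g omega, and let a generate the
    intersection of J with Z. Multiplying a and h + g omega by omega shows that g divides a and h;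
    multiplying h + g omega by the conjugate of B + omega gives A | N(B + omega). *)
Lemma quad_ideal_basis (J : set (quad D)) z : (forall x y, J x -> J y -> J (x + y)) ->
  (forall a x, J x -> J (a * x)) -> J z -> z != 0 ->
  exists g A B C, [/\ 0 < g, 0 < A, N B 1 = C * A & J = dilate (qint D g) (olat A B)].
Proof.
move=> JD JM Jz z0.
have n0 : N z.1 z.2 != 0.
  by apply: contra_neq z0; case: z {Jz} => a b /Q0_eq0[/= -> ->].
have Jn : J (qint D (N z.1 z.2)) by rewrite -mul_qconj mulrC; apply: JM.
have JE (x y : quad D) : x = y -> J x -> J y by move=> ->.
have JB x y : J x -> J y -> J (x - y).
  by move=> Jx Jy; apply: JD => //; rewrite -mulN1r; apply: JM.
have [g g0 [[h Jh] gdvd]] : exists2 g, 0 < g & (exists h, J (h, g)) /\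
    forall y, (exists x, J (x, y)) -> exists q, y = q * g.
  apply: int_subgroup_gen n0.
    move=> y y' [x Jx] [x' Jx']; exists (x - x'); exact: JB Jx Jx'.
  exists 0; apply: JE (JM (0, 1) _ Jn); congr pair => /=; ring.
have [a a0 [Ja advd]] : exists2 a, 0 < a & J (a, 0) /\
    forall x, J (x, 0) -> exists q, x = q * a.
  apply: int_subgroup_gen n0 => // x x' Jx Jx'.
  by apply: JE (JB _ _ Jx Jx'); congr pair.
have [A AE] : exists A, a = A * g.
  by apply: gdvd; exists 0; apply: JE (JM (0, 1) _ Ja); congr pair => /=; ring.
have [B BE] : exists B, h = B * g.
  have [q qE] : exists q, h + s * g = q * g.
    apply: gdvd; exists (m * g).
    by apply: JE (JM (0, 1) _ Jh); congr pair => /=; ring.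
  by exists (q - s); rewrite mulrBl -qE addrK.
have [C CE] : exists C, g * N B 1 = C * a.
  apply: advd; apply: JE (JM (qconj (B, 1)) _ Jh); rewrite BE /Q0 !intz.
  by congr pair => /=; ring.
exists g, A, B, C; split=> //.
- by rewrite -(pmulr_lgt0 _ g0) -AE.
- by apply: (mulfI (lt0r_neq0 g0)); rewrite CE AE; ring.
apply/seteqP; split=> [[x y] Jxy|_ [_ [c [b ->]] ->]].
  have [b bE] : exists b, y = b * g by apply: gdvd; exists x.
  have [c cE] : exists c, x - b * h = c * a.
    apply: advd; apply: JE (JB _ _ Jxy (JM (qint D b) _ Jh)); rewrite bE.
    congr pair => /=; last by rewrite !(mul0r, mulr0, addr0) subrr.
    by rewrite !(mul0r, mulr0, addr0).
  exists (c * A + b * B, b); first by exists c, b.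
  congr pair => /=; last by rewrite bE; ring.
  by rewrite -[x](subrK (b * h)) cE AE BE; ring.
apply: JE (JD _ _ (JM (qint D c) _ Ja) (JM (qint D b) _ Jh)).
by rewrite AE BE; congr pair => /=; ring.
Qed.
End IdealBases.

(** * Ideal classes of forms and the image of rho *)

Section Rho.
Variables (D : fund_disc) (K : fieldExtType rat) (sqrtD : K).
Hypothesis sqrtD2 : sqrtD ^+ 2 = (disc D)%:~R.
Hypothesis K_gen : <<1; sqrtD>>%VS = fullv.
Local Notation s := (sigma D).
Local Notation m := (mpar D).
Local Notation N := (Q0 D).
Local Notation om := (omega D sqrtD).
Local Notation phi := (@qmap D K om).
Local Notation O := (integers (K := K)).
Implicit Types (d : form_data D) (I J : set (quad D)).

Let phiM := qmapM (omega_sqr sqrtD2).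
Let phi_inj' := phi_inj sqrtD2.
Let O_phi := integers_phi sqrtD2 K_gen.

Lemma scale_phi z I : scale (phi z) (phi @` I) = phi @` dilate z I.
Proof.
apply/seteqP; split=> [_ [_ [y Iy <-] ->]|_ [_ [y Iy ->] <-]].
  by exists (z * y); [exists y | exact: phiM].
by exists (phi y); [exists y | exact: phiM].
Qed.

Lemma scale_phi_int (k : int) I : scale k%:~R (phi @` I) = phi @` dilate (qint D k) I.
Proof. by rewrite -scale_phi qmap_int. Qed.

Lemma phi_image_inj I J : phi @` I = phi @` J -> I = J.
Proof.
suff H I' J' : phi @` I' `<=` phi @` J' -> I' `<=` J'.
  by move=> /seteqP[IJ JI]; apply/seteqP; split; apply: H.
by move=> IJ z Iz; have [|y Jy /phi_inj'<-//] := IJ (phi z); exists z.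
Qed.

Lemma phi_frac I z : (forall x y, I x -> I y -> I (x + y)) ->
  (forall a x, I x -> I (a * x)) -> I z -> z != 0 -> fractional_ideal (phi @` I).
Proof.
move=> ID IM Iz z0; split.
- by move=> _ _ [x Ix <-] [y Iy <-]; exists (x + y); [exact: ID | rewrite qmapD].
- rewrite O_phi => _ _ [a _ <-] [x Ix <-].
  by exists (a * x); [exact: IM | rewrite phiM].
- exists (phi z); first by exists z.
  by apply: contra_neq z0 => /(qmap_eq0 (omega_sqr sqrtD2) (@intr_field_eq0 K)).
exists 1; first by split; [exact: integers1 | exact: oner_neq0].
by move=> _ [x _ <-]; rewrite mul1r O_phi; exists x.
Qed.

Lemma olat_frac A B C : A != 0 -> N B 1 = C * A ->
  fractional_ideal (phi @` olat A B).
Proof.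
move=> A0 NE; apply: (@phi_frac _ (A, 0)); first exact: olatD.
- by move=> a x; apply: olat_ideal NE.
- by exists 1, 0; congr pair; ring.
- by apply: contra_neq A0 => -[].
Qed.

Lemma scale_frac a (I : set K) : a != 0 -> fractional_ideal I ->
  fractional_ideal (scale a I).
Proof.
move=> a0 [ID IM [x Ix x0] [e [Oe e0] eI]]; split.
- by move=> _ _ [y Iy ->] [t It ->]; exists (y + t); [exact: ID | rewrite mulrDr].
- by move=> b _ Ob [y Iy ->]; exists (b * y); [exact: IM | rewrite mulrCA].
- by exists (a * x); [exists x | rewrite mulf_neq0].
(* A multiple n / a in Z[omega] turns the denominator e of I into one of a I. *)
have [z [n [n0 E]]] := quad_coord sqrtD2 K_gen a^-1.
have z0 : phi z != 0 by rewrite -E mulf_neq0 ?invr_eq0 ?intr_field_eq0.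
exists (e * phi z).
  by split; [apply: integersM; rewrite // O_phi; exists z | rewrite mulf_neq0].
move=> _ [y Iy ->]; rewrite -E.
have -> : e * (n%:~R * a^-1) * (a * y) = n%:~R * (e * y) by field.
by apply: integersM; [exact: integers_intr | exact: eI].
Qed.

Lemma lat1_frac d : fractional_ideal (phi @` lat 1 d).
Proof.
have [q qE] := leadN d; rewrite lat1E; apply: olat_frac qE.
by rewrite expf_neq0 // lt0r_neq0 ?lead_gt0.
Qed.

Let phi_mul I J : ideal_mul (phi @` I) (phi @` J) = phi @` ideal_mul I J :=
  qmap_ideal_mul (omega_sqr sqrtD2) I J.

(** The inverse is the conjugate lattice divided by the norm A^2. *)
Lemma lat1_invertible d : invertible (phi @` lat 1 d).
Proof.
have n0 : (lead d ^+ 2)%:~R != 0 :> K.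
  by rewrite intr_field_eq0 expf_neq0 // lt0r_neq0 ?lead_gt0.
exists (scale (lead d ^+ 2)%:~R^-1 (phi @` lat 1 (data_inv d))).
  by apply: scale_frac; [rewrite invr_eq0 | exact: lat1_frac].
rewrite -[phi @` lat 1 d]scale1 scale_mul mul1r phi_mul ideal_mulC lat_mul_inv.
by rewrite -scale_phi_int scaleM mulVf // scale1 O_phi.
Qed.

Lemma form_idealE d : form_ideal sqrtD d = phi @` olat (lead d) (shift d).
Proof.
apply/seteqP; split=> [_ [i [j ->]]|_ [_ [i [j ->]] <-]].
  exists (i * lead d + j * shift d, j); first by exists i, j.
  by rewrite /qmap /= intrD !intrM; ring.
by exists i, j; rewrite /qmap /= intrD !intrM; ring.
Qed.

Lemma form_ideal_mul d :
  ideal_mul (form_ideal sqrtD d) (form_ideal sqrtD d) = phi @` lat 1 d.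
Proof. by rewrite form_idealE phi_mul form_ideal_sqr. Qed.

Fact lat_ideal_subproof d :
  `[< fractional_ideal (phi @` lat 1 d) /\ invertible (phi @` lat 1 d) >].
Proof. by apply/asboolP; split; [exact: lat1_frac | exact: lat1_invertible]. Qed.

Definition lat_ideal d : inv_ideal K := InvIdeal (lat_ideal_subproof d).

Fact form_inv_ideal_subproof d :
  `[< fractional_ideal (form_ideal sqrtD d) /\ invertible (form_ideal sqrtD d) >].
Proof.
have [q qE] := leadN d.
have fr : fractional_ideal (form_ideal sqrtD d).
  rewrite form_idealE; apply: (@olat_frac _ _ (q * lead d)).
    by rewrite lt0r_neq0 ?lead_gt0.
  by rewrite qE; ring.
apply/asboolP; split=> //; have [J FJ E] := lat1_invertible d.
(* If J inverts the square of an ideal, then the ideal times J inverts the ideal. *)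
exists (ideal_mul (form_ideal sqrtD d) J); first exact: ideal_mul_frac.
by rewrite ideal_mulA form_ideal_mul.
Qed.

Definition form_inv_ideal d : inv_ideal K := InvIdeal (form_inv_ideal_subproof d).

Lemma form_inv_ideal_sqr d : (form_inv_ideal d ^+ 2)%g = lat_ideal d.
Proof. by rewrite expg2; apply: val_inj; apply: form_ideal_mul. Qed.

(** Defined by L(A, b) itself, which is the square of A Z + (b + omega) Z, so that [lat_mul] applies
    directly. *)
Definition rho (f : F2 D) : narrow_class_group K :=
  narrow_class (lat_ideal (repr f)).

Lemma rho_class d : rho (form_class d) = narrow_class (lat_ideal d).
Proof.
rewrite /rho; congr narrow_class; apply: val_inj => /=.
by rewrite (lat_class 1 (same_class_repr d)).
Qed.

Lemma totally_positive_int (k : int) : 0 < k -> totally_positive (k%:~R : K).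
Proof.
move=> k0; split=> [|f _]; first by rewrite intr_field_eq0 gt_eqF.
by rewrite rmorph_int ltr0z.
Qed.

(** Lattices multiply as their forms up to the factor [esq], a positive integer and so totally
    positive. *)
Fact rho_morph : {morph rho : f g / (f * g)%g}.
Proof.
move=> f g; have [d1 ->] := form_class_surj f; have [d2 ->] := form_class_surj g.
rewrite [(_ * _)%g]F2_mul_class !rho_class [RHS]class_mulE.
apply/narrow_classP/asboolP; exists (esq d1 d2)%:~R.
  exact/totally_positive_int/esq_gt0.
by rewrite /= phi_mul lat_mul scale_phi_int -lat_dilate !mul1r mulr1.
Qed.

Fact rho1 : rho 1%g = 1%g.
Proof. by apply: (mulgI (rho 1%g)); rewrite -rho_morph !mulg1. Qed.

HB.instance Definition _ := isUMagmaMorphism.Build _ _ rho (pair rho1 rho_morph).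

Lemma range_rho : range rho = @squares (narrow_class_group K).
Proof.
apply/seteqP; split=> [_ [f _ <-]|_ [c ->]].
  have [d ->] := form_class_surj f; rewrite rho_class -form_inv_ideal_sqr.
  exists (narrow_class (form_inv_ideal d)).
  by rewrite !expg2 [RHS]class_mulE.
have [I ->] := narrow_class_surj c.
have [ID IM [x Ix x0] [e [Oe e0] eI]] := frac_idealP I.
move: (Oe); rewrite O_phi => -[z _ zE].
(* k is the norm of the denominator e, an integral multiple of e, so k I lies in Z[omega]. *)
set k := N z.1 z.2.
have k0 : k%:~R != 0 :> K.
  rewrite intr_field_eq0; apply: contra_neq e0 => /Q0_eq0[a0 b0].
  by rewrite -zE /qmap a0 b0 mul0r addr0.
have kE : k%:~R = phi (qconj z) * e by rewrite -zE -phiM mulrC mul_qconj qmap_int.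
pose J : set (quad D) := [set y | ideal_set I (phi y / k%:~R)].
have IJ : scale k%:~R I = phi @` J.
  apply/seteqP; split=> [_ [y Iy ->]|_ [y Jy <-]]; last first.
    by exists (phi y / k%:~R); rewrite // mulrC divfK.
  have : O (k%:~R * y).
    rewrite kE -mulrA; apply: integersM; last exact: eI.
    by rewrite O_phi; exists (qconj z).
  rewrite O_phi => -[t _ tE]; exists t; last by rewrite tE.
  by rewrite /J /= tE mulrC mulKf.
have [t Jt tE] : (phi @` J) (k%:~R * x) by rewrite -IJ; exists x.
have t0 : t != 0.
  by apply: contra_neq x0 => t0; apply: (mulfI k0); rewrite -tE t0 mulr0 qmap0.
have [g [A [B [C [g0 A0 NE JE]]]]] : exists g A B C, [/\ 0 < g, 0 < A, N B 1 = C * A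
    & J = dilate (qint D g) (olat A B)].
  apply: quad_ideal_basis t0 => //.
    by move=> y y' Jy Jy'; rewrite /J /= qmapD mulrDl; apply: ID.
  move=> a y Jy; rewrite /J /= phiM -mulrA; apply: IM => //.
  by rewrite O_phi; exists a.
have [d [h [h0 hE]]] := olat_sqr_form A0 NE.
exists (form_class d) => //; rewrite rho_class !expg2 [RHS]class_mulE.
(* From k I = g (A Z + (B + omega) Z) the square of I is g^2 h / k^2 times L(d); this rational is
   positive whatever the sign of k. *)
apply/narrow_classP/asboolP; exists ((g ^+ 2 * h)%:~R / (k ^+ 2)%:~R).
  apply: totally_positiveM; first by apply: totally_positive_int; rewrite mulr_gt0 ?exprn_gt0.
  apply/totally_positiveV/totally_positive_int.
  by rewrite exprn_even_gt0 //= -(intr_field_eq0 K).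
have k20 : (k ^+ 2)%:~R != 0 :> K by rewrite rmorphXn expf_neq0.
rewrite mulrC -scaleM scale_phi_int -lat_dilate mulr1 lat_dilate -hE.
rewrite [g ^+ 2]expr2 qintM -dilate_mul -JE -phi_mul -IJ scale_mul scaleM.
by rewrite -intrM -expr2 mulVf // scale1.
Qed.
End Rho.

(** * Rational points and the map theta *)

Section Theta.
Variable D : fund_disc.
Local Notation s := (sigma D).
Local Notation m := (mpar D).
Local Notation N := (Q0 D).
Implicit Types (p q : pell D rat) (d : form_data D).

(** The denominator divides the square of the numerator, to which it is prime. *)
Lemma rat_root_int (x : rat) (k c : int) :
  x ^+ 2 + k%:~R * x + c%:~R = 0 -> exists u : int, u%:~R = x.
Proof.
move=> E; exists (numq x); rewrite -[RHS]divq_num_den.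
suff -> : denq x = 1 by rewrite divr1.
have F : numq x ^+ 2 = (- (k * numq x) - c * denq x) * denq x.
  apply: (@intr_inj rat); move: (numqE x) => nE.
  rewrite rmorphXn intrM rmorphB rmorphN /= !intrM nE; apply/eqP.
  rewrite -subr_eq0; apply/eqP.
  transitivity ((denq x)%:~R ^+ 2 * (x ^+ 2 + k%:~R * x + c%:~R)); first by ring.
  by rewrite E mulr0.
have cop : coprimez (denq x) (numq x ^+ 2).
  by rewrite coprimezXr // coprimezE coprime_sym coprime_num_den.
have : (denq x %| 1 * numq x ^+ 2)%Z by rewrite mul1r F dvdz_mull.
rewrite Gauss_dvdzl // => d1; by apply: gtz_dvd_eq; rewrite ?denq_gt0 ?dvd1z.
Qed.

Lemma least_inverse_exists (n v : int) : 0 < n -> coprimez n v ->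
  exists a, least_inverse_mod n v a.
Proof.
move=> n0 /coprimezP[[t a0] /= E].
pose P (k : nat) := (0 < k)%N && ((k%:Z * v)%R == 1 %[mod n])%Z.
have exP : exists k, P k.
  (* Adding n keeps the inverse positive even when the residue is 0, as for n = 1. *)
  have a1 : 0 < (a0 %% n)%Z + n by rewrite ltr_wpDl ?modz_ge0 ?gt_eqF.
  exists `|((a0 %% n)%Z + n)%R|%N; rewrite /P absz_gt0 gt_eqF //= gez0_abs ?ltW //.
  rewrite eqz_mod_dvd; apply/dvdzP; exists (v - (a0 %/ n)%Z * v - t).
  have rE : (a0 %% n)%Z = a0 - (a0 %/ n)%Z * n by rewrite {2}(divz_eq a0 n) addrC addKr.
  by rewrite rE; apply: (@eq_lincomb _ _ 1 _ _ E); ring.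
case: (ex_minnP exP) => a /andP[a_gt0 /eqP aE] amin; exists a%:Z; split=> //.
move=> a' a'0 a'E; have absE : `|a'|%N%:Z = a' by rewrite gez0_abs // ltW.
rewrite -absE lez_nat; apply: amin.
by rewrite /P absz_gt0 gt_eqF //= absE; apply/eqP.
Qed.

(** z is A (x + y omega), with A the denominator. *)
Definition scaled_point p (z : quad D) : Prop :=
  z.1%:~R = (denominator p)%:~R * p.1 /\ z.2%:~R = (denominator p)%:~R * p.2.

(** The generator z is recorded along with the data, since every property of theta on lattices goes
    through it. *)
Lemma theta_exists p : exists d, [/\ lead d = denominator p, is_ratio p (shift d)
  & exists z, scaled_point p z /\ lat 1 d = dilate z setT].
Proof.
set A := denominator p; set v := numq p.2.
have A0 : 0 < A := denq_gt0 _.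
have n0 : 0 < A ^+ 2 by rewrite exprn_gt0.
have vE : v%:~R = A%:~R * p.2 :> rat by rewrite /v numqE mulrC.
have [u uE] : exists u : int, u%:~R = A%:~R * p.1 :> rat.
  (* Multiplying Q0(x, y) = 1 by A^2 makes A x a root of X^2 + sigma v X - m v^2 - A^2. *)
  apply: (@rat_root_int _ (s * v) (- (m * v ^+ 2) - A ^+ 2)).
  transitivity (A%:~R ^+ 2 * (N p.1 p.2 - 1)); last by rewrite pellP subrr mulr0.
  rewrite /Q0; move: s m => S0 M.
  by rewrite rmorphB rmorphN /= !(rmorphXn, intrM) /= vE; ring.
have nE : N u v = A ^+ 2.
  apply: (@intr_inj rat); transitivity (N (u%:~R : rat) v%:~R).
    rewrite /Q0 !intz; move: s m => S0 M.
    by rewrite rmorphB rmorphD /= !(rmorphXn, intrM).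
  transitivity (A%:~R ^+ 2 * N p.1 p.2); first by rewrite uE vE /Q0; ring.
  by rewrite pellP mulr1 rmorphXn.
have cop : coprimez (A ^+ 2) v.
  by rewrite coprimezXl // coprimezE coprime_sym coprime_num_den.
have [b bP bv] : exists2 b : int, (if p.2 == 0 then b = 0 else
      exists a u v : int,
        [/\ u%:~R = A%:~R * p.1, v%:~R = A%:~R * p.2,
            least_inverse_mod (A ^+ 2) v a & b = a * u]) & (A ^+ 2 %| u - v * b)%Z.
  case: eqP => [y0|_].
    (* For y = 0 the denominator is 1 and the divisibility is trivial. *)
    exists 0 => //; rewrite {1}/A /denominator y0; exact: dvd1z.
  have [a aP] := least_inverse_exists n0 cop.
  exists (a * u); first by exists a, u, v.
  case: aP => _ /eqP aE _; move: aE; rewrite eqz_mod_dvd => /dvdzP[t tE].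
  apply/dvdzP; exists (- (u * t)); apply: (@eq_lincomb _ _ (- u) _ _ tE); ring.
set beta := (b %% A ^+ 2)%Z.
have bv' : (A ^+ 2 %| u - v * beta)%Z.
  have bE := divz_eq b (A ^+ 2); rewrite -/beta in bE.
  case/dvdzP: bv => t tE; apply/dvdzP; exists (t + v * (b %/ A ^+ 2)%Z).
  by rewrite mulrDl -tE {1}bE; ring.
have fc : form_cond D (A, beta).
  (* v is prime to A, and v^2 N(beta) = N(v beta, v) is congruent to N(u, v) = A^2 modulo A^2. *)
  rewrite /form_cond A0 /= -(@Gauss_dvdzr _ (v ^+ 2)) ?coprimezXr //.
  case/dvdzP: bv' => t tE; apply/dvdzP.
  exists (1 - 2 * v * beta * t - t ^+ 2 * A ^+ 2 - s * v * t).
  have uE' : u = v * beta + t * A ^+ 2 by rewrite -tE; ring.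
  move: nE; rewrite uE' /Q0 !intz => nE.
  by apply: (@eq_lincomb _ _ 1 _ _ nE); ring.
exists (FormData fc); split=> //; first by exists b.
by exists (u, v); split=> //; apply: lat1_principal.
Qed.

Definition theta_data p : form_data D := projT1 (cid (theta_exists p)).
Definition theta p : F2 D := form_class (theta_data p).

Lemma lead_theta p : lead (theta_data p) = denominator p.
Proof. by rewrite /theta_data; case: cid => ? /= []. Qed.

Lemma ratio_theta p : is_ratio p (shift (theta_data p)).
Proof. by rewrite /theta_data; case: cid => ? /= []. Qed.

Lemma lat_theta p : exists z, scaled_point p z /\ lat 1 (theta_data p) = dilate z setT.
Proof. by rewrite /theta_data; case: cid => ? /= []. Qed.

Lemma denominator_gt0 p : 0 < denominator p. Proof. exact: denq_gt0. Qed.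

(** Let z, w, t be the scaled points of p, q and their product. As x + y omega is multiplicative, t
    times the denominators of p and q equals z w times that of the product, so both lattices become
    equal after scaling by positive integers. *)
Fact theta_morph : {morph theta : p q / (p * q)%g}.
Proof.
move=> p q; rewrite /theta [RHS]F2_mul_class; apply/form_classP.
have [z [[z1 z2] zE]] := lat_theta p; have [w [[w1 w2] wE]] := lat_theta q.
have [t [[t1 t2] tE]] := lat_theta (p * q)%g.
have := lat_mul 1 1 (theta_data p) (theta_data q).
rewrite zE wE dilate_mul ideal_mul_setT !mul1r => E.
apply: (@same_class_lat _ (denominator p * denominator q)
  (denominator (p * q)%g * esq (theta_data p) (theta_data q))).
- by rewrite mulr_gt0 ?denominator_gt0.
- by rewrite mulr_gt0 ?denominator_gt0 ?esq_gt0.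
rewrite [in RHS]qintM -dilateM -[dilate (qint _ (esq _ _)) _]lat_dilate.
rewrite mulr1 -E tE !dilateM; congr dilate.
move: t1 t2 z1 z2 w1 w2; set A := denominator _; set B := denominator q.
set C := denominator p; case: z w t {zE wE tE E} => [a b] [a' b'] [e f] /=.
move=> eE fE aE bE a'E b'E; congr pair => /=; apply: (@intr_inj rat).
  transitivity ((C%:~R * B%:~R) * e%:~R : rat); first by rewrite !(mulr0, mul0r, addr0) !intrM.
  transitivity (A%:~R * (a%:~R * a'%:~R + m%:~R * b%:~R * b'%:~R) : rat).
    by rewrite eE aE bE a'E b'E; ring.
  by move: m => M; rewrite !(mul0r, mulr0, addr0) intrM intrD !intrM.
transitivity ((C%:~R * B%:~R) * f%:~R : rat).
  by rewrite !(mulr0, mul0r, addr0) !intrM.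
transitivity (A%:~R * (a%:~R * b'%:~R + b%:~R * a'%:~R + s%:~R * b%:~R * b'%:~R) : rat).
  by rewrite fE aE bE a'E b'E; ring.
by move: s => S0; rewrite !(mulr0, mul0r, addr0) intrM !intrD !intrM.
Qed.

Fact theta1 : theta 1%g = 1%g.
Proof. by apply: (mulgI (theta 1%g)); rewrite -theta_morph !mulg1. Qed.

HB.instance Definition _ := isUMagmaMorphism.Build _ _ theta (pair theta1 theta_morph).

Lemma pell_incl_inj : injective (@pell_incl D).
Proof.
move=> [[a b] ab] [[a' b'] ab'] /(congr1 val) /= [/intr_inj aE /intr_inj bE].
by apply: val_inj; rewrite /= aE bE.
Qed.

(** All shifts agree modulo 1, so the identity is the only class with A = 1. *)
Lemma theta_eq1 p : theta p = 1%g <-> denominator p = 1.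
Proof.
rewrite -lead_theta; split=> [/form_classP/same_classP[-> _] // | E].
apply/form_classP/same_classP; split; first by rewrite E.
by rewrite E; exists (shift (theta_data p) - shift (data_one D)); rewrite expr1n mulr1.
Qed.

Lemma range_pell_incl : range (@pell_incl D) = kernel theta.
Proof.
apply/seteqP; split=> [_ [p _ <-]|p /theta_eq1 E].
  by apply/theta_eq1; rewrite /denominator /= denq_int.
(* The denominator only concerns y; the scaled point shows that x is integral as well. *)
have [[u v] [[/= uE vE] _]] := lat_theta p; rewrite E !mul1r in uE vE.
have uv : N ((u, v) : int * int).1 ((u, v) : int * int).2 == 1.
  apply/eqP/(@intr_inj rat); rewrite -[RHS](pellP p) /Q0 /= -uE -vE !intz.
  by move: s m => S0 M; rewrite rmorphB rmorphD /= !(rmorphXn, intrM).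
exists (Pell uv) => //; apply: val_inj => /=; rewrite uE vE.
by rewrite -surjective_pairing.
Qed.
End Theta.

(** * Exactness at the group of forms *)

Section Exactness.
Variables (D : fund_disc) (K : fieldExtType rat) (sqrtD : K).
Hypothesis sqrtD2 : sqrtD ^+ 2 = (disc D)%:~R.
Hypothesis K_gen : <<1; sqrtD>>%VS = fullv.
Local Notation N := (Q0 D).
Local Notation phi := (@qmap D K (omega D sqrtD)).

(** The point is z / A. Its own scaled point is a rational multiple of z, so its lattice and L(d)
    are proportional and the classes agree. *)
Lemma theta_of_principal d z : lat 1 d = dilate z setT ->
  N z.1 z.2 = lead d ^+ 2 -> range (@theta D) (form_class d).
Proof.
move=> dE nE; have A0 := lead_gt0 d.
have AQ : (lead d)%:~R != 0 :> rat by rewrite intr_eq0 gt_eqF.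
pose r : rat * rat := (z.1%:~R / (lead d)%:~R, z.2%:~R / (lead d)%:~R).
have rP : N r.1 r.2 == 1.
  apply/eqP/(mulfI (expf_neq0 2 AQ)).
  transitivity (N (z.1%:~R : rat) z.2%:~R); first by rewrite /Q0 /=; field.
  rewrite mulr1 -rmorphXn /= -nE /Q0 !intz; move: (sigma D) (mpar D) => S0 M.
  by rewrite rmorphB rmorphD /= !(rmorphXn, intrM).
exists (Pell rP) => //; apply/form_classP.
have [w [[w1 w2] wE]] := lat_theta (Pell rP).
apply: (@same_class_lat _ (lead d) (denominator (Pell rP))) => //.
  exact: denominator_gt0.
rewrite wE dE !dilateM; congr dilate; move: w1 w2; rewrite /=; set A := denominator _.
case: w {wE} => [e f] /= eE fE.
congr pair => /=; apply: (@intr_inj rat); rewrite !(mul0r, mulr0, addr0) !intrM.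
  by rewrite eE mulrCA; congr (_ * _); rewrite mulrC divfK.
by rewrite fE mulrCA; congr (_ * _); rewrite mulrC divfK.
Qed.

(** The lattice of a rational point is generated by z of norm A^2 > 0, and z or - z is totally
    positive. Conversely, a totally positive generator has positive norm, which [principal_norm]
    identifies as A^2. *)
Lemma range_theta : range (@theta D) = kernel (rho sqrtD2 K_gen).
Proof.
have Ophi := integers_phi sqrtD2 K_gen.
apply/seteqP; split=> [_ [p _ <-]|f]; rewrite /kernel /=.
  have [z [[z1 z2] zE]] := lat_theta p.
  have nz : 0 < N z.1 z.2.
    rewrite -(ltr_int rat).
    have -> : (N z.1 z.2)%:~R = (denominator p)%:~R ^+ 2 :> rat.
      transitivity (N (z.1%:~R : rat) z.2%:~R).
        rewrite /Q0 !intz; move: (sigma D) (mpar D) => S0 M.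
        by rewrite rmorphB rmorphD /= !(rmorphXn, intrM).
      transitivity ((denominator p)%:~R ^+ 2 * N p.1 p.2).
        by rewrite z1 z2 /Q0; ring.
      by rewrite pellP mulr1.
    by rewrite exprn_gt0 // ltr0z denominator_gt0.
  rewrite /theta rho_class; symmetry; apply/narrow_classP/asboolP => /=.
  have [zp|zp] := totally_positive_up_to_sign sqrtD2 nz.
    by exists (phi z); rewrite // Ophi scale_phi // zE.
  exists (phi (- z)); rewrite // Ophi scale_phi // zE; congr (_ @` _).
  by apply/seteqP; split=> _ [y _ ->]; exists (- y); rewrite // ?mulrNN ?mulNr ?mulrN.
have [d ->] := form_class_surj f; rewrite rho_class => /esym/narrow_classP/asboolP[a ap /= E].
have [z _ zE] : (phi @` lat 1 d) a.
  by rewrite E; exists 1; [exact: integers1 | rewrite mulr1].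
have dE : lat 1 d = dilate z setT.
  by apply: (phi_image_inj sqrtD2); rewrite -scale_phi // -Ophi zE; apply: E.
apply: (theta_of_principal dE); apply: (principal_norm dE).
by apply: (norm_gt0_of_totally sqrtD2 K_gen); rewrite zE.
Qed.
End Exactness.

Theorem theorem4p2 (D : fund_disc) (K : fieldExtType rat) (sqrtD : K)
    (sqrtD2 : sqrtD ^+ 2 = (disc D)%:~R)
    (K_gen : <<1; sqrtD>>%VS = fullv) :
  exists (theta : {multiplicative pell D rat -> F2 D})
         (rho : {multiplicative F2 D -> narrow_class_group K}),
    [/\ forall p : pell D rat, exists d : form_data D,
          [/\ lead d = denominator p, is_ratio p (shift d)
            & theta p = form_class d],
        forall d : form_data D, exists A : inv_ideal K,
          ideal_set A = form_ideal sqrtD d /\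
          rho (form_class d) = narrow_class (A ^+ 2)%g
      & [/\ injective (@pell_incl D),
            range (@pell_incl D) = kernel theta,
            range theta = kernel rho
          & range rho = @squares (narrow_class_group K)]].
Proof.
exists (@theta D), (rho sqrtD2 K_gen); split.
- move=> p; exists (theta_data p).
  by split; [exact: lead_theta | exact: ratio_theta |].
- move=> d; exists (form_inv_ideal sqrtD2 K_gen d); split=> //.
  by rewrite form_inv_ideal_sqr; apply: rho_class.
split; [exact: pell_incl_inj | exact: range_pell_incl | exact: range_theta |].
exact: range_rho.
Qed.
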